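(* Let $\mathcal O$ be a complete discrete valuation ring with field of fractions of characteristic $0$ and finite residue field $\kappa$ of characteristic $p$. Let $\mathbb R_{\mathcal O}$ be the Greenberg algebra of $\mathcal O$ (a ring scheme over $\kappa$), let $\mathbb W_{\mathcal O,\kappa}=\mathbb W_{\mathcal O}\times_{\mathcal O}\mathrm{Spec}(\kappa)$ be the special fiber of the scheme of ramified Witt vectors over $\mathcal O$, and let $\boldsymbol r\colon \mathbb R_{\mathcal O}\to \mathbb W_{\mathcal O,\kappa}$ be the morphism of $\kappa$-ring schemes given on $A$-sections, for every $\kappa$-algebra $A$, by the homomorphism of $\mathcal O$-algebras $r_A\colon W(A)\otimes_{W(\kappa)}\mathcal O\to W_{\mathcal O}(A)$ induced by Drinfeld's map. Then $\boldsymbol r$ induces an isomorphism $\boldsymbol r^{\mathrm{pf}}\colon \mathbb R_{\mathcal O}^{\mathrm{pf}}\to \mathbb W_{\mathcal O,\kappa}^{\mathrm{pf}}$ on (inverse) perfections. Hence $\boldsymbol r$ is a universal homeomorphism, thus surjective, and it has pro-infinitesimal kernel.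
   Context: **Ramified Witt vectors.** Let $\mathcal O$ be a complete discrete valuation ring with finite residue field $\kappa$ of cardinality $q=p^h$ and fixed uniformizer $\pi$. For an $\mathcal O$-algebra $B$, $W_{\mathcal O}(B)$ is the set $B^{\mathbb N_0}$ endowed with the unique $\mathcal O$-algebra structure, functorial in $B$, such that for every $B$ the map $\Phi_B\colon W_{\mathcal O}(B)\to B^{\mathbb N_0}$, $\boldsymbol b=(b_n)_n\mapsto(\Phi_n(\boldsymbol b))_n$, with $\Phi_n(\boldsymbol b)=b_0^{q^n}+\pi b_1^{q^{n-1}}+\dots+\pi^n b_n$, is a homomorphism of $\mathcal O$-algebras ($B^{\mathbb N_0}$ on the right is the product ring, with $\mathcal O$ acting componentwise). $\mathbb W_{\mathcal O}=\mathrm{Spec}\,\mathcal O[X_0,X_1,\dots]$ is the ring scheme over $\mathcal O$ representing $B\mapsto W_{\mathcal O}(B)$. For $\mathcal O=\mathbb Z_p$, $\pi=p$, one gets the usual $p$-typical Witt vectors: $W_{\mathbb Z_p}(B)=W(B)$. **Drinfeld's map.** Let $\mathcal O'$ be the ring of integers of a finite extension of $\mathrm{Frac}(\mathcal O)$, with residue field of cardinality $q^r$ and fixed uniformizer $\varpi$; let $\Phi'_n$ be the analogous polynomials for $\mathcal O'$ (with $\varpi,q^r$ in place of $\pi,q$). There is a unique morphism of $\mathcal O'$-ring schemes $\boldsymbol u=\boldsymbol u_{(\mathcal O,\mathcal O')}\colon \mathbb W_{\mathcal O}\times_{\mathcal O}\mathrm{Spec}(\mathcal O')\to\mathbb W_{\mathcal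 O'}$ such that $\Phi'_n(u_B(\boldsymbol b))=\Phi_{nr}(\boldsymbol b)$ for all $n\ge 0$, all $\mathcal O'$-algebras $B$ and all $\boldsymbol b\in W_{\mathcal O}(B)$, where $u_B\colon W_{\mathcal O}(B)\to W_{\mathcal O'}(B)$ is the induced map on $B$-sections; $u_B$ is a homomorphism of $\mathcal O$-algebras. **Greenberg algebra.** $\mathbb R_{\mathcal O}$ is the affine ring scheme over $\kappa$ with $\mathbb R_{\mathcal O}(A)=W(A)\otimes_{W(\kappa)}\mathcal O$ for every $\kappa$-algebra $A$; it is the inverse limit of the Greenberg algebras $\mathbb R_n$ of the artinian rings $\mathcal O/\pi^n\mathcal O$, where $\mathbb R_n$ represents the fpqc sheaf associated to $\mathrm{Spec}(A)\mapsto W(A)\otimes_{W(\kappa)}\mathcal O/\pi^n\mathcal O$. **The morphism $\boldsymbol r$.** For a $\kappa$-algebra $A$, $r_A\colon W(A)\otimes_{W(\kappa)}\mathcal O\to W_{\mathcal O}(A)$ is the $\mathcal O$-algebra homomorphism $x\otimes\lambda\mapsto \lambda\, u_A(x)$, where $u=u_{(\mathbb Z_p,\mathcal O)}$. **Perfection.** For a $\kappa$-scheme $X$, $X^{\mathrm{pf}}$ is the inverse limit of copies of $X$ with the absolute Frobenius $F_X$ as transition maps; $X\mapsto X^{\mathrm{pf}}$ is right adjoint to the forgetful functor from perfect $\kappa$-schemes ($F_X$ an isomorphism) to $\kappa$-schemes. **Pro-infinitesimal.** An affine $\kappa$-group scheme is pro-infinitesimal if it is an inverse limit of infinitesimal $\kappa$-group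 schemes (finite $\kappa$-group schemes whose underlying space is one point). *)

(* Defs.v *)
From HB Require Import structures.
From mathcomp Require Import all_boot all_order all_algebra.
From mathcomp Require Import boolp classical_sets functions.
From mathcomp Require Import topology.

Set Implicit Arguments.
Unset Strict Implicit.
Unset Printing Implicit Defensive.

Import GRing.Theory.

Local Open Scope classical_set_scope.
Local Open Scope ring_scope.

(* [comPzRingType] allows the zero ring, which the ideals and algebras of the
   library exclude and which is a legitimate test ring for functors of points. *)
Definition ideal (A : comPzRingType) (I : set A) : Prop :=
  [/\ I 0, forall x y, I x -> I y -> I (x + y) & forall a x, I x -> I (a * x)].

Definition prime_ideal (A : comPzRingType) (P : set A) : Prop :=
  [/\ ideal P, ~ P 1 & forall x y, P (x * y) -> P x \/ P y].

Definition principal (A : comPzRingType) (a : A) : set A :=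
  [set a * x | x in [set: A]].

(* A principal ideal domain with exactly one nonzero prime ideal. *)
Definition is_dvr (O : idomainType) : Prop :=
  (forall I : set O, ideal I -> exists a, I = principal a) /\
  exists! P : set O, prime_ideal P /\ P <> [set 0].

Definition is_uniformizer (O : idomainType) (pi : O) : Prop :=
  prime_ideal (principal pi) /\ pi != 0.

Definition adically_complete (O : idomainType) (pi : O) : Prop :=
  forall x : nat -> O,
    (forall n, exists N, forall i j, (N <= i)%N -> (N <= j)%N ->
       principal (pi ^+ n) (x i - x j)) ->
    exists l, forall n, exists N, forall i, (N <= i)%N ->
       principal (pi ^+ n) (x i - l).

Definition is_residue_map (O : idomainType) (pi : O) (kappa : fieldType)
    (res : {rmorphism O -> kappa}) : Prop :=
  (forall c, exists x, res x = c) /\ forall x, res x = 0 <-> principal pi x.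

Record alg (k : comPzRingType) := Alg {
  alg_ring :> comPzRingType;
  alg_str : {rmorphism k -> alg_ring} }.

Record algHom (k : comPzRingType) (A B : alg k) := AlgHom {
  alg_hom :> {rmorphism A -> B};
  alg_homP : forall c, alg_hom (alg_str A c) = alg_str B c }.

Definition alg_id (k : comPzRingType) (A : alg k) : algHom A A :=
  @AlgHom k A A (@idfun A) (fun=> erefl).

Lemma alg_comp_subproof (k : comPzRingType) (A B C : alg k)
    (g : algHom B C) (f : algHom A B) c :
  (g \o f) (alg_str A c) = alg_str C c.
Proof. by rewrite /= !alg_homP. Qed.

Definition alg_comp (k : comPzRingType) (A B C : alg k)
    (g : algHom B C) (f : algHom A B) : algHom A C :=
  @AlgHom k A C (g \o f) (alg_comp_subproof g f).

Definition base_alg (k : comPzRingType) : alg k := @Alg k k (@idfun k).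

Definition alg_unit (k : comPzRingType) (A : alg k) : algHom (base_alg k) A :=
  @AlgHom k (base_alg k) A (alg_str A) (fun=> erefl).

Definition restrict_alg (k l : comPzRingType) (phi : {rmorphism k -> l})
    (A : alg l) : alg k := @Alg k A (alg_str A \o phi).

Definition restrict_hom (k l : comPzRingType) (phi : {rmorphism k -> l})
    (A B : alg l) (f : algHom A B) :
    algHom (restrict_alg phi A) (restrict_alg phi B) :=
  @AlgHom k (restrict_alg phi A) (restrict_alg phi B) f
    (fun c => alg_homP f (phi c)).

Definition Zalg (A : comPzRingType) : alg int := @Alg int A (intmul 1).

Definition Zhom (A B : comPzRingType) (f : {rmorphism A -> B}) :
    algHom (Zalg A) (Zalg B) :=
  @AlgHom int (Zalg A) (Zalg B) f (rmorph_int f).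

Definition is_pushout (A B C D : comPzRingType)
    (f : {rmorphism A -> B}) (g : {rmorphism A -> C})
    (b : {rmorphism B -> D}) (c : {rmorphism C -> D}) : Prop :=
  (forall x, b (f x) = c (g x)) /\
  forall (E : comPzRingType) (b' : {rmorphism B -> E}) (c' : {rmorphism C -> E}),
    (forall x, b' (f x) = c' (g x)) ->
    exists2 d : {rmorphism D -> E},
      (forall x, d (b x) = b' x) /\ (forall x, d (c x) = c' x) &
      forall d' : {rmorphism D -> E},
        (forall x, d' (b x) = b' x) -> (forall x, d' (c x) = c' x) -> d' =1 d.

Record functor (k : comPzRingType) := Functor {
  fobj :> alg k -> Type;
  fmap : forall A B, algHom A B -> fobj A -> fobj B;
  fmap_id : forall A x, fmap (alg_id A) x = x;
  fmap_comp : forall A B C (g : algHom B C) (f : algHom A B) x,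
    fmap (alg_comp g f) x = fmap g (fmap f x) }.

Record natTrans (k : comPzRingType) (F G : functor k) := NatTrans {
  ntmap :> forall A, F A -> G A;
  ntmapP : forall A B (f : algHom A B) x,
    ntmap (fmap f x) = fmap f (ntmap x) }.

Record ringFunctor (k : comPzRingType) := RingFunctor {
  robj :> alg k -> comPzRingType;
  rmap : forall A B, algHom A B -> {rmorphism robj A -> robj B};
  rmap_id : forall A x, rmap (alg_id A) x = x;
  rmap_comp : forall A B C (g : algHom B C) (f : algHom A B) x,
    rmap (alg_comp g f) x = rmap g (rmap f x) }.

Coercion ringFunctor_functor (k : comPzRingType) (F : ringFunctor k) :
    functor k :=
  @Functor k (fun A => robj F A) (fun A B f => rmap F f) (@rmap_id k F) (@rmap_comp k F).

Record ringMap (k : comPzRingType) (F G : ringFunctor k) := RingMap {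
  rtmap :> forall A, {rmorphism F A -> G A};
  rtmapP : forall A B (f : algHom A B) x,
    rtmap B (rmap F f x) = rmap G f (rtmap A x) }.

Coercion ringMap_natTrans (k : comPzRingType) (F G : ringFunctor k)
    (r : ringMap F G) : natTrans F G :=
  @NatTrans k F G (fun A => rtmap r A) (@rtmapP k F G r).

Record groupFunctor (k : comPzRingType) := GroupFunctor {
  gobj :> alg k -> groupType;
  gmap : forall A B, algHom A B -> {multiplicative gobj A -> gobj B};
  gmap_id : forall A x, gmap (alg_id A) x = x;
  gmap_comp : forall A B C (g : algHom B C) (f : algHom A B) x,
    gmap (alg_comp g f) x = gmap g (gmap f x) }.

Coercion groupFunctor_functor (k : comPzRingType) (F : groupFunctor k) :
    functor k :=
  @Functor k (fun A => gobj F A) (fun A B f => gmap F f) (@gmap_id k F) (@gmap_comp k F).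

Record groupMap (k : comPzRingType) (F G : groupFunctor k) := GroupMap {
  gtmap :> forall A, {multiplicative F A -> G A};
  gtmapP : forall A B (f : algHom A B) x,
    gtmap B (gmap F f x) = gmap G f (gtmap A x) }.

Lemma algHom_inj (k : comPzRingType) (A B : alg k) (f g : algHom A B) :
  alg_hom f = alg_hom g -> f = g.
Proof.
by case: f g => [f fP] [g gP] /= fg; subst g; congr AlgHom; exact: Prop_irrelevance.
Qed.

Section Restrict.
Variables (k l : comPzRingType) (phi : {rmorphism k -> l}) (F : ringFunctor k).

Lemma restrict_id A x : rmap F (restrict_hom phi (alg_id A)) x = x.
Proof.
by rewrite (_ : restrict_hom _ _ = alg_id _) ?rmap_id //; exact: algHom_inj.
Qed.

Lemma restrict_comp A B C (g : algHom B C) (f : algHom A B) x :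
  rmap F (restrict_hom phi (alg_comp g f)) x =
  rmap F (restrict_hom phi g) (rmap F (restrict_hom phi f) x).
Proof.
rewrite -rmap_comp; congr (rmap F _ x); exact: algHom_inj.
Qed.

(* The functor of points of the base change along [phi] is the restriction of
   the functor of points to [l]-algebras. *)
Definition base_change : ringFunctor l :=
  @RingFunctor l (fun A => F (restrict_alg phi A))
    (fun A B f => rmap F (restrict_hom phi f)) restrict_id restrict_comp.

End Restrict.

Section Absolute.
Variables (k : comPzRingType) (F : ringFunctor int).

Lemma absolute_id (A : alg k) x : rmap F (Zhom (alg_id A)) x = x.
Proof.
by rewrite (_ : Zhom _ = alg_id _) ?rmap_id //; exact: algHom_inj.
Qed.

Lemma absolute_comp (A B C : alg k) (g : algHom B C) (f : algHom A B) x :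
  rmap F (Zhom (alg_comp g f)) x = rmap F (Zhom g) (rmap F (Zhom f) x).
Proof. by rewrite -rmap_comp; congr (rmap F _ x); exact: algHom_inj. Qed.

(* A functor on all commutative rings, viewed as a functor on [k]-algebras. *)
Definition absolute : ringFunctor k :=
  @RingFunctor k (fun A => F (Zalg A)) (fun A B f => rmap F (Zhom f))
    absolute_id absolute_comp.

End Absolute.

(* [coord_ring] is the coordinate ring of the affine scheme with functor of points
   [F], and [univ_pt] is its universal point. *)
Record representation (k : comPzRingType) (F : functor k) := Representation {
  coord_ring : alg k;
  univ_pt : F coord_ring;
  univ_ptP : forall (T : alg k) (y : F T),
    exists2 f : algHom coord_ring T,
      fmap f univ_pt = y & forall f' : algHom coord_ring T, fmap f' univ_pt = y -> f' =1 f }.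

Definition comorphism (k : comPzRingType) (F G : functor k)
    (rF : representation F) (rG : representation G) (r : natTrans F G) :
    algHom (coord_ring rG) (coord_ring rF) :=
  sval (cid2 (univ_ptP rG (r _ (univ_pt rF)))).

Record Spec (A : comPzRingType) := MkSpec {
  pideal :> A -> Prop;
  pidealP : prime_ideal pideal }.

HB.instance Definition _ (A : comPzRingType) := gen_eqMixin (Spec A).
HB.instance Definition _ (A : comPzRingType) := gen_choiceMixin (Spec A).

Section Zariski.
Variable A : comPzRingType.

Definition zariski_open (U : set (Spec A)) : Prop :=
  exists E : set A, U = [set P : Spec A | exists2 a, E a & ~ P a].

Lemma zariski_openT : zariski_open setT.
Proof.
exists setT; apply/seteqP; split => // P _; exists 1 => //.
by have [] := pidealP P.
Qed.

Lemma zariski_openI : setI_closed zariski_open.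
Proof.
move=> _ _ [E ->] [F ->].
exists [set a * b | a in E & b in F]; apply/seteqP; split => P /=.
  move=> [[a Ea Pa] [b Fb Pb]]; exists (a * b); first by exists a => //; exists b.
  by have [_ _ prP] := pidealP P; case/prP.
have [[_ _ PM] _ _] := pidealP P.
move=> [_ [a Ea [b Fb <-]] Pab]; split.
  by exists a => // /(PM b); rewrite mulrC.
by exists b => // /(PM a).
Qed.

Lemma zariski_open_bigU (I : Type) (f : I -> set (Spec A)) :
  (forall i, zariski_open (f i)) -> zariski_open (\bigcup_i f i).
Proof.
move=> /choice [E fE]; exists (\bigcup_i E i); apply/seteqP; split => P /=.
  by move=> [i _]; rewrite fE => -[a Ea Pa]; exists a => //; exists i.
by move=> [a [i _ Ea] Pa]; exists i => //; rewrite fE; exists a.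
Qed.

HB.instance Definition _ := isOpenTopological.Build (Spec A)
  zariski_openT zariski_openI zariski_open_bigU.

End Zariski.

Lemma spec_map_subproof (A B : comPzRingType) (f : {rmorphism A -> B})
    (P : Spec B) : prime_ideal (f @^-1` (pideal P)).
Proof.
have [[P0 PD PM] P1 PP] := pidealP P; split => /=.
- split => /=; first by rewrite rmorph0.
    by move=> x y Px Py; rewrite rmorphD; exact: PD.
  by move=> a x Px; rewrite rmorphM; exact: PM.
- by rewrite rmorph1.
- by move=> x y; rewrite rmorphM; exact: PP.
Qed.

Definition spec_map (A B : comPzRingType) (f : {rmorphism A -> B})
    (P : Spec B) : Spec A := MkSpec (spec_map_subproof f P).

Definition is_homeomorphism (X Y : topologicalType) (f : X -> Y) : Prop :=
  exists g : Y -> X, [/\ cancel f g, cancel g f, continuous f & continuous g].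

(* Being a homeomorphism is local on the target, so it is enough to base change
   [Spec B -> Spec A] along morphisms of affine schemes [Spec A' -> Spec A]. *)
Definition universal_homeomorphism (A B : comPzRingType)
    (f : {rmorphism A -> B}) : Prop :=
  forall (A' B' : comPzRingType) (g : {rmorphism A -> A'})
    (g' : {rmorphism B -> B'}) (f' : {rmorphism A' -> B'}),
    is_pushout f g g' f' -> is_homeomorphism (spec_map f').

Definition spec_surjective (A B : comPzRingType) (f : {rmorphism A -> B}) :
    Prop :=
  forall P : Spec A, exists Q : Spec B, spec_map f Q = P.

(* The colimit of A -> A -> A -> ... along the Frobenius x |-> x ^+ p; its
   spectrum is the inverse limit of copies of Spec A along the absolute
   Frobenius. *)
Record perfection (p : nat) (A : comPzRingType) := Perfection {
  pf_ring :> comPzRingType;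
  pf_in : nat -> {rmorphism A -> pf_ring};
  pf_inS : forall n a, pf_in n.+1 (a ^+ p) = pf_in n a;
  pf_univ : forall (B : comPzRingType) (g : nat -> {rmorphism A -> B}),
    (forall n a, g n.+1 (a ^+ p) = g n a) ->
    exists2 d : {rmorphism pf_ring -> B},
      (forall n a, d (pf_in n a) = g n a) &
      forall d' : {rmorphism pf_ring -> B},
        (forall n a, d' (pf_in n a) = g n a) -> d' =1 d }.

Definition iso_on_perfections (p : nat) (A B : comPzRingType)
    (f : {rmorphism A -> B}) : Prop :=
  forall (PA : perfection p A) (PB : perfection p B),
    exists2 fpf : {rmorphism PA -> PB},
      (forall n a, fpf (pf_in PA n a) = pf_in PB n (f a)) & bijective fpf.

Definition module_finite (k : comPzRingType) (A : alg k) : Prop :=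
  exists s : seq A, forall x : A, exists c : nat -> k,
    x = \sum_(i < size s) alg_str A (c i) * s`_i.

Definition infinitesimal (k : comPzRingType) (G : groupFunctor k) : Prop :=
  exists rG : representation G,
    module_finite (coord_ring rG) /\ exists P : Spec (coord_ring rG), forall Q, Q = P.

Definition is_directed (I : Type) (le : I -> I -> Prop) : Prop :=
  [/\ forall i, le i i,
      forall i j l, le i j -> le j l -> le i l,
      exists i : I, True &
      forall i j, exists l, le i l /\ le j l].

(* Limits of affine group schemes are computed on points. *)
Definition pro_infinitesimal (k : comPzRingType) (G : groupFunctor k) : Prop :=
  inhabited (representation G) /\
  exists (I : Type) (le : I -> I -> Prop) (H : I -> groupFunctor k)
    (t : forall i j, le i j -> groupMap (H j) (H i))
    (c : forall i, groupMap G (H i)),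
  [/\ is_directed le /\ forall i, infinitesimal (H i),
      (forall i (ii : le i i) T x, t i i ii T x = x) /\
      (forall i j l (ij : le i j) (jl : le j l) (il : le i l) T x,
         t i j ij T (t j l jl T x) = t i l il T x),
      forall i j (ij : le i j) T x, t i j ij T (c j T x) = c i T x &
      forall T (y : forall i, H i T),
        (forall i j (ij : le i j), t i j ij T (y j) = y i) ->
        exists! x : G T, forall i, c i T x = y i].

(* The additive group of the kernel, written multiplicatively as a
   [groupType]. *)
Section KernelGroup.
Variables (U V : comPzRingType) (f : {rmorphism U -> V}).

Record kernel_pt := KernelPt { kernel_val : U; _ : f kernel_val == 0 }.

HB.instance Definition _ := [isSub for kernel_val].
HB.instance Definition _ := [Choice of kernel_pt by <:].

Lemma kernelP (x : kernel_pt) : f (val x) = 0.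
Proof. exact/eqP/(valP x). Qed.

Fact kernel0_subproof : f 0 == 0. Proof. by rewrite rmorph0. Qed.

Fact kernelN_subproof (x : kernel_pt) : f (- val x) == 0.
Proof. by rewrite rmorphN kernelP oppr0. Qed.

Fact kernelD_subproof (x y : kernel_pt) : f (val x + val y) == 0.
Proof. by rewrite rmorphD !kernelP addr0. Qed.

Definition kernel0 := KernelPt kernel0_subproof.
Definition kernelN (x : kernel_pt) := KernelPt (kernelN_subproof x).
Definition kernelD (x y : kernel_pt) := KernelPt (kernelD_subproof x y).

Fact kernel_addA : associative kernelD.
Proof. by move=> x y z; apply: val_inj; rewrite /= addrA. Qed.
Fact kernel_add0 : left_id kernel0 kernelD.
Proof. by move=> x; apply: val_inj; rewrite /= add0r. Qed.
Fact kernel_addr0 : right_id kernel0 kernelD.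
Proof. by move=> x; apply: val_inj; rewrite /= addr0. Qed.
Fact kernel_addN : left_inverse kernel0 kernelN kernelD.
Proof. by move=> x; apply: val_inj; rewrite /= addNr. Qed.
Fact kernel_addrN : right_inverse kernel0 kernelN kernelD.
Proof. by move=> x; apply: val_inj; rewrite /= addrN. Qed.

HB.instance Definition _ := isGroup.Build kernel_pt
  kernel_addA kernel_add0 kernel_addr0 kernel_addN kernel_addrN.

End KernelGroup.

Section Kernel.
Variables (k : comPzRingType) (F G : ringFunctor k) (r : ringMap F G).

Section Map.
Variables (A B : alg k) (f : algHom A B).

Fact kernel_map_subproof (x : kernel_pt (r A)) : r B (rmap F f (val x)) == 0.
Proof. by rewrite rtmapP kernelP rmorph0. Qed.

Definition kernel_map (x : kernel_pt (r A)) : kernel_pt (r B) :=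
  KernelPt (kernel_map_subproof x).

Fact kernel_map_mul : {morph kernel_map : x y / (x * y)%g}.
Proof. by move=> x y; apply: val_inj; rewrite /= rmorphD. Qed.

HB.instance Definition _ := isMultiplicative.Build
  (kernel_pt (r A)) (kernel_pt (r B)) kernel_map kernel_map_mul.

End Map.

Fact kernel_map_id A (x : kernel_pt (r A)) : kernel_map (alg_id A) x = x.
Proof. by apply: val_inj; rewrite /= rmap_id. Qed.

Fact kernel_map_comp A B C (g : algHom B C) (f : algHom A B)
    (x : kernel_pt (r A)) :
  kernel_map (alg_comp g f) x = kernel_map g (kernel_map f x).
Proof. by apply: val_inj; rewrite /= rmap_comp. Qed.

Definition kernel : groupFunctor k :=
  @GroupFunctor k (fun A => kernel_pt (r A)) (fun A B f => kernel_map f)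
    kernel_map_id kernel_map_comp.

End Kernel.

Definition ghost (O : comPzRingType) (pi : O) (q : nat) (B : alg O)
    (b : nat -> B) (n : nat) : B :=
  \sum_(i < n.+1) alg_str B (pi ^+ i) * b i ^+ (q ^ (n - i))%N.

Definition seq_ring (B : comPzRingType)
    (c : GRing.ComPzRing.axioms_ (nat -> B)) : comPzRingType :=
  GRing.ComPzRing.Pack c.

(* The O-algebra structure on B^nat, functorial in B, for which the ghost map is
   a homomorphism of O-algebras to the product ring B^nat; it is given by its
   ring structure [witt_class] and its structure map [witt_str]. It exists and
   is unique for O a complete discrete valuation ring with uniformizer pi and
   residue field of cardinality q, and also for O = int and pi = q = p prime,
   where it is the ring of p-typical Witt vectors. *)
Record wittVectors (O : comPzRingType) (pi : O) (q : nat) := WittVectors {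
  witt_class : forall B : alg O, GRing.ComPzRing.axioms_ (nat -> B);
  witt_str : forall B : alg O, {rmorphism O -> seq_ring (witt_class B)};
  witt_map : forall (B C : alg O), algHom B C ->
    {rmorphism seq_ring (witt_class B) -> seq_ring (witt_class C)};
  witt_mapE : forall (B C : alg O) (f : algHom B C) (b : nat -> B) (n : nat),
    (witt_map f b : nat -> C) n = f (b n);
  witt_map_str : forall (B C : alg O) (f : algHom B C) a,
    witt_map f (witt_str B a) = witt_str C a;
  witt_ghost : forall (B : alg O) (n : nat),
    {rmorphism seq_ring (witt_class B) -> B};
  witt_ghostE : forall (B : alg O) (n : nat) (b : nat -> B),
    witt_ghost B n b = ghost pi q b n;
  witt_ghost_str : forall (B : alg O) (n : nat) a,
    witt_ghost B n (witt_str B a) = alg_str B a }.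

Section WittFunctor.
Variables (O : comPzRingType) (pi : O) (q : nat) (W : wittVectors pi q).

Fact witt_map_id (B : alg O) x : witt_map W (alg_id B) x = x.
Proof. by apply: funext => n; rewrite witt_mapE. Qed.

Fact witt_map_comp (A B C : alg O) (g : algHom B C) (f : algHom A B) x :
  witt_map W (alg_comp g f) x = witt_map W g (witt_map W f x).
Proof. by apply: funext => n; rewrite !witt_mapE. Qed.

Definition witt : ringFunctor O :=
  @RingFunctor O (fun B => seq_ring (witt_class W B))
    (fun A B f => witt_map W f) witt_map_id witt_map_comp.

Definition wcoef (B : alg O) (b : witt B) : nat -> B := b.

End WittFunctor.

(* Drinfeld's map from p-typical Witt vectors to ramified Witt vectors over O,
   where the residue field of O has cardinality p ^ h. *)
Definition is_drinfeld_map (O : comPzRingType) (pi : O) (p h : nat)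
    (W : wittVectors (p%:Z) p) (WO : wittVectors pi (p ^ h)%N)
    (u : ringMap (absolute O (witt W)) (witt WO)) : Prop :=
  forall (B : alg O) (b : absolute O (witt W) B) (n : nat),
    ghost pi (p ^ h)%N (wcoef (u B b)) n =
    ghost (p%:Z) p (wcoef (b : witt W (Zalg B))) (n * h)%N.

(* [j : W(kappa) -> O] is the canonical map over which the tensor product is
   taken, and (x, l) |-> greenberg_l x * greenberg_r l is the universal bilinear
   map (x, l) |-> x (x) l. *)
Record greenberg (O : comPzRingType) (kappa : comPzRingType) (F : ringFunctor int)
    (j : {rmorphism absolute kappa F (base_alg kappa) -> O})
    (R : ringFunctor kappa) := Greenberg {
  greenberg_l : ringMap (absolute kappa F) R;
  greenberg_r : forall A : alg kappa, {rmorphism O -> R A};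
  greenberg_rP : forall (A B : alg kappa) (f : algHom A B) l,
    rmap R f (greenberg_r A l) = greenberg_r B l;
  greenberg_pushout : forall A : alg kappa,
    is_pushout (rmap (absolute kappa F) (alg_unit A)) j
      (greenberg_l A) (greenberg_r A) }.

(* Main.v *)
(** For every [kappa]-algebra [A], [O] is free over [W(kappa)] on the powers
    [pi ^ i], [i < e], so [R_O(A)] is [W(A) ^ e] and [r_A] sends a row [x] to
    [sum_i pi ^ i u(x_i)].  If [A] is perfect, then [W_O(A)] is [pi]-torsion free,
    [pi ^ k W_O(A)] consists of the vectors with [k] leading zeros,
    [W_O(A) / pi = A], and [p] is a unit times [pi ^ e]; successive approximation
    modulo [p] then shows that [r_A] is bijective.  Evaluating at the perfections
    of the coordinate rings gives the isomorphism of perfections.  Hence the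
    comorphism is, after any base change, surjective up to [p]-power roots with nil
    kernel, which makes it a universal homeomorphism.

    Dwork's congruences for ghost components show that [u] maps [V ^ k W(A)] into
    [V ^ (e k) W_O(A)] for every [A].  Thus [r] induces maps between truncations,
    and its kernel is the limit of the kernels [H_k] of these.  By the strict form
    of the bijectivity above, [H_k] has only the zero point over perfect algebras,
    so the finitely many coordinates generating its algebra are nilpotent. *)

Require Import Defs.
From HB Require Import structures.
From mathcomp Require Import all_boot all_order all_algebra.
From mathcomp Require Import boolp classical_sets functions.
From mathcomp Require Import topology.
From mathcomp Require Import finmap.
From mathcomp Require Import ring.
From mathcomp.multinomials Require Import monalg.

Set Implicit Arguments.
Unset Strict Implicit.
Unset Printing Implicit Defensive.

Import GRing.Theory.

Local Open Scope ring_scope.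

(** * Subrings and quotients *)

(** Witt vectors and the Greenberg algebra are known here only through ghost components and
    universal properties, and this shapes the argument. Ghost components do not determine a vector
    once [pi] is zero, so coordinate identities in [W_O(A)] are checked over a [pi]-torsion free
    [O]-algebra mapping onto [A] and carried down by naturality. Freeness of [O] over [W(kappa)]
    passes to [R_O(A)] for arbitrary [A] by mapping the pushout into an explicit ring of matrices.
    One abstract expansion argument, for a map [phi] from [W(A)] to a ring with a regular element
    [t] such that [p] is a unit times [t ^+ e], serves twice: with [A = kappa] and target [O] it
    gives the basis, with [A] perfect and target [W_O(A)] the bijectivity of [r_A]. Bijectivity
    alone does not control truncations, since a truncated kernel contains points whose images vanish
    only in the first coordinates; hence the quantitative form: a row whose image is divisible by
    [t ^+ (e * k)] has all entries in [V ^ k W(A)]. *)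

Section Subring.
Variables (M : pzRingType) (P : M -> Prop).

(** The ambient ring may be noncommutative, because one use is a commutative ring of matrices. *)
Record subring : Prop := Subring {
  subringB : forall x y, P x -> P y -> P (x - y);
  subring1 : P 1;
  subringM : forall x y, P x -> P y -> P (x * y) }.

Hypotheses (PR : subring) (PC : forall x y, P x -> P y -> x * y = y * x).

Lemma subring0 : P 0.
Proof. by rewrite -(subrr 1); apply: subringB => //; apply: subring1. Qed.

Lemma subringN x : P x -> P (- x).
Proof. by move=> Px; rewrite -sub0r; apply: subringB => //; apply: subring0. Qed.

Lemma subringD x y : P x -> P y -> P (x + y).
Proof.
by move=> Px Py; rewrite -[y]opprK; apply: subringB => //; apply: subringN.
Qed.

Lemma subring_sum I (r : seq I) (F : I -> M) :
  (forall i, P (F i)) -> P (\sum_(i <- r) F i).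
Proof.
move=> PF; elim/big_ind : _ => //; [exact: subring0 | exact: subringD].
Qed.

Record sub_pt := SubPt { sub_val : M; sub_asP : `[< P sub_val >] }.
HB.instance Definition _ := [isSub for sub_val].
HB.instance Definition _ := [Choice of sub_pt by <:].

Lemma sub_valP (x : sub_pt) : P (val x).
Proof. exact/asboolP/(valP x). Qed.

Definition sub_mk x (Px : P x) : sub_pt := SubPt (introT (asboolP _) Px).

(** The two proofs are parameters of the type, so that the ring instances built from them can be
    inferred from the type. *)
Definition sub_type (_ : subring) (_ : forall x y, P x -> P y -> x * y = y * x) :=
  sub_pt.
Local Notation S := (sub_type PR PC).
HB.instance Definition _ := Choice.on S.

Let s0 : S := sub_mk subring0.
Let s1 : S := sub_mk (subring1 PR).
Let sN (x : S) : S := sub_mk (subringN (sub_valP x)).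
Let sD (x y : S) : S := sub_mk (subringD (sub_valP x) (sub_valP y)).
Let sM (x y : S) : S := sub_mk (subringM PR (sub_valP x) (sub_valP y)).

Fact sub_addA : associative sD.
Proof. by move=> x y z; apply: val_inj; rewrite /= addrA. Qed.
Fact sub_addC : commutative sD.
Proof. by move=> x y; apply: val_inj; rewrite /= addrC. Qed.
Fact sub_add0 : left_id s0 sD.
Proof. by move=> x; apply: val_inj; rewrite /= add0r. Qed.
Fact sub_addN : left_inverse s0 sN sD.
Proof. by move=> x; apply: val_inj; rewrite /= addNr. Qed.
HB.instance Definition _ := GRing.isZmodule.Build S
  sub_addA sub_addC sub_add0 sub_addN.

Fact sub_mulA : associative sM.
Proof. by move=> x y z; apply: val_inj; rewrite /= mulrA. Qed.
Fact sub_mulC : commutative sM.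
Proof.
by move=> x y; apply: val_inj; rewrite /= PC //; apply: sub_valP.
Qed.
Fact sub_mul1 : left_id s1 sM.
Proof. by move=> x; apply: val_inj; rewrite /= mul1r. Qed.
Fact sub_mulD : left_distributive sM sD.
Proof. by move=> x y z; apply: val_inj; rewrite /= mulrDl. Qed.
HB.instance Definition _ := GRing.Zmodule_isComPzRing.Build S
  sub_mulA sub_mulC sub_mul1 sub_mulD.

Definition sub_ring : comPzRingType := S.

Definition sub_incl (x : sub_ring) : M := val (x : sub_pt).
Fact sub_incl_additive : zmod_morphism sub_incl.
Proof. by []. Qed.
Fact sub_incl_multiplicative : monoid_morphism sub_incl.
Proof. by []. Qed.
HB.instance Definition _ :=
  GRing.isZmodMorphism.Build sub_ring M sub_incl sub_incl_additive.
HB.instance Definition _ :=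
  GRing.isMonoidMorphism.Build sub_ring M sub_incl sub_incl_multiplicative.

Lemma sub_incl_inj : injective sub_incl.
Proof. by move=> x y xy; apply: val_inj. Qed.

Lemma sub_inclP x : P (sub_incl x).
Proof. exact: sub_valP. Qed.

Section Lift.
Variables (A : pzRingType) (f : {rmorphism A -> M}) (fP : forall a, P (f a)).
Definition sub_lift (a : A) : sub_ring := sub_mk (fP a).
Fact sub_lift_additive : zmod_morphism sub_lift.
Proof. by move=> x y; apply: val_inj; rewrite /= rmorphB. Qed.
Fact sub_lift_multiplicative : monoid_morphism sub_lift.
Proof.
by split=> [|x y]; apply: val_inj; rewrite /= ?rmorph1 ?rmorphM.
Qed.
HB.instance Definition _ :=
  GRing.isZmodMorphism.Build A sub_ring sub_lift sub_lift_additive.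
HB.instance Definition _ :=
  GRing.isMonoidMorphism.Build A sub_ring sub_lift sub_lift_multiplicative.
Lemma sub_liftK a : sub_incl (sub_lift a) = f a.
Proof. by []. Qed.
End Lift.

End Subring.

Definition rmorph_of (A B : pzRingType) (f : A -> B) (fB : zmod_morphism f)
    (fM : monoid_morphism f) : {rmorphism A -> B} :=
  let fA := GRing.isZmodMorphism.Build A B f fB in
  let fL := GRing.isMonoidMorphism.Build A B f fM in
  HB.pack_for {rmorphism A -> B} f fA fL.

Section RingQuotient.
Local Open Scope quotient_scope.
Variables (T : choiceType) (E : T -> T -> Prop).
Variables (z o : T) (opp : T -> T) (add mul : T -> T -> T).

Record ring_congruence : Prop := RingCongruence {
  cong_refl : forall x, E x x;
  cong_sym : forall x y, E x y -> E y x;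
  cong_trans : forall x y t, E x y -> E y t -> E x t;
  cong_opp : forall x y, E x y -> E (opp x) (opp y);
  cong_add : forall x x' y y', E x x' -> E y y' -> E (add x y) (add x' y');
  cong_mul : forall x x' y y', E x x' -> E y y' -> E (mul x y) (mul x' y');
  cong_addA : forall x y t, E (add x (add y t)) (add (add x y) t);
  cong_addC : forall x y, E (add x y) (add y x);
  cong_add0 : forall x, E (add z x) x;
  cong_addN : forall x, E (add (opp x) x) z;
  cong_mulA : forall x y t, E (mul x (mul y t)) (mul (mul x y) t);
  cong_mulC : forall x y, E (mul x y) (mul y x);
  cong_mul1 : forall x, E (mul o x) x;
  cong_mulD : forall x y t, E (mul (add x y) t) (add (mul x t) (mul y t)) }.

Hypothesis EP : ring_congruence.

Let e x y := `[< E x y >].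
Fact cong_equiv : equiv_class_of e.
Proof.
split=> [x|x y|y x t]; first by apply/asboolP; apply: cong_refl.
  by apply/asboolP/asboolP; apply: cong_sym.
by move=> /asboolP xy /asboolP yt; apply/asboolP; apply: (cong_trans EP xy).
Qed.
Definition cong_rel := EquivRelPack cong_equiv.

Definition quot := {eq_quot cong_rel}.
HB.instance Definition _ := Choice.on quot.
Definition quot_pi (x : T) : quot := \pi_{eq_quot cong_rel} x.
Definition quot_repr (x : quot) : T := repr (x : {eq_quot cong_rel}).

Lemma quot_eqP x y : quot_pi x = quot_pi y <-> E x y.
Proof.
split=> [/eqmodP /asboolP //|xy]; apply/eqmodP; exact/asboolP.
Qed.

Lemma quot_reprK x : quot_pi (quot_repr x) = x.
Proof. exact: reprK. Qed.

Lemma quot_repr_pi x : E (quot_repr (quot_pi x)) x.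
Proof. by apply/quot_eqP; rewrite quot_reprK. Qed.

Lemma quot_surj x : exists y, x = quot_pi y.
Proof. by exists (quot_repr x); rewrite quot_reprK. Qed.

Let qN x := quot_pi (opp (quot_repr x)).
Let qD x y := quot_pi (add (quot_repr x) (quot_repr y)).
Let qM x y := quot_pi (mul (quot_repr x) (quot_repr y)).

Let qN_pi x : qN (quot_pi x) = quot_pi (opp x).
Proof. by apply/quot_eqP; apply: cong_opp => //; apply: quot_repr_pi. Qed.
Let qD_pi x y : qD (quot_pi x) (quot_pi y) = quot_pi (add x y).
Proof. by apply/quot_eqP; apply: cong_add => //; apply: quot_repr_pi. Qed.
Let qM_pi x y : qM (quot_pi x) (quot_pi y) = quot_pi (mul x y).
Proof. by apply/quot_eqP; apply: cong_mul => //; apply: quot_repr_pi. Qed.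

Fact quot_addA : associative qD.
Proof.
move=> x y t.
have [[x' ->] [y' ->] [t' ->]] := And3 (quot_surj x) (quot_surj y) (quot_surj t).
by rewrite !qD_pi; apply/quot_eqP/cong_addA.
Qed.
Fact quot_addC : commutative qD.
Proof.
move=> x y; have [[x' ->] [y' ->]] := conj (quot_surj x) (quot_surj y).
by rewrite !qD_pi; apply/quot_eqP/cong_addC.
Qed.
Fact quot_add0 : left_id (quot_pi z) qD.
Proof.
by move=> x; have [x' ->] := quot_surj x; rewrite qD_pi; apply/quot_eqP/cong_add0.
Qed.
Fact quot_addN : left_inverse (quot_pi z) qN qD.
Proof.
move=> x; have [x' ->] := quot_surj x; rewrite qN_pi qD_pi.
exact/quot_eqP/cong_addN.
Qed.
HB.instance Definition _ := GRing.isZmodule.Build quot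
  quot_addA quot_addC quot_add0 quot_addN.

Fact quot_mulA : associative qM.
Proof.
move=> x y t.
have [[x' ->] [y' ->] [t' ->]] := And3 (quot_surj x) (quot_surj y) (quot_surj t).
by rewrite !qM_pi; apply/quot_eqP/cong_mulA.
Qed.
Fact quot_mulC : commutative qM.
Proof.
move=> x y; have [[x' ->] [y' ->]] := conj (quot_surj x) (quot_surj y).
by rewrite !qM_pi; apply/quot_eqP/cong_mulC.
Qed.
Fact quot_mul1 : left_id (quot_pi o) qM.
Proof.
by move=> x; have [x' ->] := quot_surj x; rewrite qM_pi; apply/quot_eqP/cong_mul1.
Qed.
Fact quot_mulD : left_distributive qM qD.
Proof.
move=> x y t.
have [[x' ->] [y' ->] [t' ->]] := And3 (quot_surj x) (quot_surj y) (quot_surj t).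
by rewrite !(qD_pi, qM_pi); apply/quot_eqP/cong_mulD.
Qed.
HB.instance Definition _ := GRing.Zmodule_isComPzRing.Build quot
  quot_mulA quot_mulC quot_mul1 quot_mulD.

Definition quot_ring : comPzRingType := quot.
Definition quot_in (x : T) : quot_ring := quot_pi x.

Lemma quot_in_eq x y : quot_in x = quot_in y <-> E x y.
Proof. exact: quot_eqP. Qed.
Lemma quot_in_surj x : exists y, x = quot_in y.
Proof. exact: quot_surj. Qed.
Lemma quot_in0 : 0 = quot_in z. Proof. by []. Qed.
Lemma quot_in1 : 1 = quot_in o. Proof. by []. Qed.
Lemma quot_inN x : - quot_in x = quot_in (opp x).
Proof. exact: qN_pi. Qed.
Lemma quot_inD x y : quot_in x + quot_in y = quot_in (add x y).
Proof. exact: qD_pi. Qed.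
Lemma quot_inM x y : quot_in x * quot_in y = quot_in (mul x y).
Proof. exact: qM_pi. Qed.

Section Lift.
Variables (B : pzRingType) (f : T -> B).
Hypotheses (fE : forall x y, E x y -> f x = f y).
Hypotheses (f1 : f o = 1) (fN : forall x, f (opp x) = - f x).
Hypotheses (fD : forall x y, f (add x y) = f x + f y).
Hypotheses (fM : forall x y, f (mul x y) = f x * f y).

Lemma quot_lift :
  exists g : {rmorphism quot_ring -> B}, forall x, g (quot_in x) = f x.
Proof.
pose g (x : quot_ring) := f (quot_repr x).
have gE x : g (quot_in x) = f x by exact/fE/quot_repr_pi.
have gB : zmod_morphism g.
  move=> x y; have [[x' ->] [y' ->]] := conj (quot_in_surj x) (quot_in_surj y).
  by rewrite quot_inN quot_inD !gE fD fN.
have gM : monoid_morphism g.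
  split=> [|x y]; first by rewrite quot_in1 gE.
  have [[x' ->] [y' ->]] := conj (quot_in_surj x) (quot_in_surj y).
  by rewrite quot_inM !gE fM.
by exists (rmorph_of gB gM).
Qed.
End Lift.

End RingQuotient.

Section IdealQuotient.
Variables (A : comPzRingType) (I : set A) (II : ideal I).

Fact ideal_congruence :
  ring_congruence (fun x y : A => I (x - y)) 0 1 -%R +%R *%R.
Proof.
have [I0 ID IM] := II; have IN x : I x -> I (- x) by rewrite -mulN1r; apply: IM.
have IE x y : x = y -> I (x - y) by move=> ->; rewrite subrr.
split.
- by move=> x; apply: IE.
- by move=> x y /IN; rewrite opprB.
- by move=> x y t xy /(ID _ _ xy); rewrite addrA subrK.
- by move=> x y /IN; rewrite opprD.
- by move=> x x' y y' xx /(ID _ _ xx); rewrite addrACA opprD.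
- move=> x x' y y' xx yy; rewrite (_ : _ - _ = y * (x - x') + x' * (y - y')).
    by apply: ID; apply: IM.
  by rewrite !mulrBr addrA (mulrC y x) (mulrC y x') subrK.
- by move=> x y t; apply/IE/addrA.
- by move=> x y; apply/IE/addrC.
- by move=> x; apply/IE/add0r.
- by move=> x; apply/IE/addNr.
- by move=> x y t; apply/IE/mulrA.
- by move=> x y; apply/IE/mulrC.
- by move=> x; apply/IE/mul1r.
- by move=> x y t; apply/IE/mulrDl.
Qed.

Definition ideal_quot : comPzRingType := quot_ring ideal_congruence.
Definition ideal_proj (x : A) : ideal_quot := quot_in ideal_congruence x.
Fact ideal_proj_additive : zmod_morphism ideal_proj.
Proof. by move=> x y; rewrite /ideal_proj quot_inN quot_inD. Qed.
Fact ideal_proj_multiplicative : monoid_morphism ideal_proj.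
Proof. by split=> // x y; rewrite /ideal_proj quot_inM. Qed.
HB.instance Definition _ :=
  GRing.isZmodMorphism.Build A ideal_quot ideal_proj ideal_proj_additive.
HB.instance Definition _ :=
  GRing.isMonoidMorphism.Build A ideal_quot ideal_proj ideal_proj_multiplicative.

Lemma ideal_proj_eq0 x : ideal_proj x = 0 <-> I x.
Proof.
rewrite /ideal_proj quot_in0 quot_in_eq.
by rewrite subr0.
Qed.

Lemma ideal_proj_surj y : exists x, y = ideal_proj x.
Proof. exact: quot_in_surj. Qed.

Lemma ideal_quot_lift (B : comPzRingType) (f : {rmorphism A -> B}) :
  (forall x, I x -> f x = 0) ->
  exists g : {rmorphism ideal_quot -> B}, forall x, g (ideal_proj x) = f x.
Proof.
move=> fI; have fE x y : I (x - y) -> f x = f y.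
  by move=> /fI/eqP; rewrite rmorphB subr_eq0 => /eqP.
apply: quot_lift fE _ _ _ _; first exact: rmorph1.
- exact: rmorphN.
- exact: rmorphD.
- exact: rmorphM.
Qed.

End IdealQuotient.

(** * Perfections *)

(** The inner binomial coefficients are divisible by [p]. The factor [y] is kept in the cross term
    because, for [y] divisible by [pi ^+ n] and [p] by [pi], it makes this term divisible by
    [pi ^+ n.+1]. *)
Lemma prime_exprD (A : comPzRingType) p (x y : A) : prime p ->
  exists z, (x + y) ^+ p = x ^+ p + y ^+ p + p%:R * (y * z).
Proof.
move=> pr; have := prime_gt0 pr; case: p pr => // p pr _.
rewrite exprDn big_ord_recl big_ord_recr /= subn0 expr0 mulr1 bin0 mulr1n.
rewrite /bump /= add1n subnn expr0 mul1r binn mulr1n.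
suff [z ->] : exists z, \sum_(i < p) x ^+ (p.+1 - bump 0 i) * y ^+ bump 0 i *+
    'C(p.+1, bump 0 i) = p.+1%:R * (y * z).
  by exists z; rewrite addrA -addrA (addrC _ (y ^+ _)) addrA.
elim/big_ind: _ => [|s t [z ->] [z' ->]|i _].
- by exists 0; rewrite !mulr0.
- by exists (z + z'); rewrite !mulrDr.
have /dvdnP[k ->] : (p.+1 %| 'C(p.+1, bump 0 i))%N.
  by apply: prime_dvd_bin => //; rewrite /bump /= add1n ltnS /= ltn_ord.
exists (x ^+ (p.+1 - bump 0 i) * y ^+ i *+ k).
rewrite /bump /= add1n exprS mulrnA -[in LHS]mulr_natl; congr (_ * _).
by rewrite mulrnAr mulrCA.
Qed.

Section Frobenius.
Variables (p : nat) (p_pr : prime p).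

Definition charp (A : comPzRingType) := p%:R = 0 :> A.

Lemma charp_map (A B : comPzRingType) (f : {rmorphism A -> B}) :
  charp A -> charp B.
Proof. by rewrite /charp -(rmorph_nat f) => ->; rewrite rmorph0. Qed.

Section CharP.
Variables (A : comPzRingType) (A_p : charp A).

Lemma frobD (x y : A) : (x + y) ^+ p = x ^+ p + y ^+ p.
Proof.
by have [z ->] := prime_exprD x y p_pr; rewrite A_p mul0r addr0.
Qed.

Lemma frobN (x : A) : (- x) ^+ p = - x ^+ p.
Proof.
apply/eqP; rewrite -addr_eq0 -frobD addNr expr0n; case: p p_pr => //.
Qed.

Lemma frobB (x y : A) : (x - y) ^+ p = x ^+ p - y ^+ p.
Proof. by rewrite frobD frobN. Qed.

Lemma frobXD n (x y : A) : (x + y) ^+ (p ^ n) = x ^+ (p ^ n) + y ^+ (p ^ n).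
Proof. by elim: n => [|n IH]; rewrite ?expr1 // expnSr !exprM IH frobD. Qed.

Lemma frobXB n (x y : A) : (x - y) ^+ (p ^ n) = x ^+ (p ^ n) - y ^+ (p ^ n).
Proof. by elim: n => [|n IH]; rewrite ?expr1 // expnSr !exprM IH frobB. Qed.

Lemma frobX_multiplicative n : monoid_morphism (fun x : A => x ^+ (p ^ n)).
Proof. by split=> [|x y]; rewrite ?expr1n ?exprMn. Qed.

Definition frobX n : {rmorphism A -> A} :=
  rmorph_of (frobXB n) (frobX_multiplicative n).
End CharP.

Definition perfect (A : comPzRingType) :=
  [/\ charp A, forall x : A, x ^+ p = 0 -> x = 0 & forall x : A, exists y, x = y ^+ p].

Lemma perfectX0 (A : comPzRingType) n (x : A) :
  perfect A -> x ^+ (p ^ n) = 0 -> x = 0.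
Proof.
move=> [_ A0 _]; elim: n x => [|n IH] x; first by rewrite expr1.
by rewrite expnS exprM => /IH/A0.
Qed.

Lemma perfectX_root (A : comPzRingType) n (x : A) :
  perfect A -> exists y, x = y ^+ (p ^ n).
Proof.
move=> [_ _ Ap]; elim: n => [|n [y ->]]; first by exists x; rewrite expr1.
by have [z ->] := Ap y; exists z; rewrite expnS exprM.
Qed.

Lemma perfection_unique (A : comPzRingType) (PA : perfection p A)
    (B : comPzRingType) (d d' : {rmorphism PA -> B}) :
  (forall n a, d (pf_in PA n a) = d' (pf_in PA n a)) -> d =1 d'.
Proof.
move=> dd'.
have [n a|d0 _ d0P] := @pf_univ _ _ PA B (fun n => d \o pf_in PA n).
  by rewrite /= pf_inS.
by move=> x; rewrite (d0P d) // (d0P d') // => n a; rewrite -dd'.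
Qed.

(** The shift of levels from [pf_in n a] to [pf_in n.+1 a], obtained from the universal property, is
    inverse to the Frobenius. *)
Lemma perfection_perfect (A : comPzRingType) (PA : perfection p A) :
  charp A -> perfect PA.
Proof.
move=> A_p; have PA_p := charp_map (pf_in PA 0) A_p.
have [n a|r rP _] := @pf_univ _ _ PA PA (fun n => pf_in PA n.+1).
  by rewrite pf_inS.
pose F := frobX PA_p 1.
have FrK : F \o r =1 idfun.
  apply: perfection_unique => n a.
  by rewrite /= rP /F /= expn1 -rmorphXn /= pf_inS.
have rFK : r \o F =1 idfun.
  apply: perfection_unique => n a.
  by rewrite /F /= expn1 rmorphXn /= rP -rmorphXn /= pf_inS.
split=> // x; last by exists (r x); have := FrK x; rewrite /F /= expn1.
by move=> x0; have := rFK x; rewrite /F /= expn1 x0 rmorph0.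
Qed.

Section PerfectionExists.
Variables (A : comPzRingType) (A_p : charp A).

(** The colimit along the Frobenius is realised by sequences that are eventually compatible with it,
    modulo those that are eventually zero. The element [a] of level [n] becomes
    [a ^+ (p ^ (m - n))], whose entries with [m < n] do not matter. *)
Let root_seq (s : nat -> A) := exists N, forall n, (N <= n)%N -> s n.+1 = s n ^+ p.

Fact root_seq_subring : subring root_seq.
Proof.
split=> [s t [N sN] [M tM]||s t [N sN] [M tM]].
- exists (maxn N M) => n; rewrite geq_max => /andP[Nn Mn].
  by rewrite !opprfctE /= ?addrfctE sN // tM // frobB.
- by exists 0%N => n _; rewrite expr1n.
- exists (maxn N M) => n; rewrite geq_max => /andP[Nn Mn].
  by rewrite !mulrfctE sN // tM // exprMn.
Qed.

Let S := sub_ring root_seq_subring (fun x y _ _ => mulrC x y).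
Let ev (s : S) : nat -> A := sub_incl s.
Let null (s : S) := exists N, forall n, (N <= n)%N -> ev s n = 0.

Fact null_ideal : ideal (null : set S).
Proof.
split=> [|s t [N sN] [M tM]|s t [N tN]]; first by exists 0%N.
  exists (maxn N M) => n; rewrite geq_max => /andP[Nn Mn].
  by rewrite /ev rmorphD addrfctE [X in X + _]sN // [X in _ + X]tM // addr0.
by exists N => n /tN t0; rewrite /ev rmorphM mulrfctE [X in _ * X]t0 mulr0.
Qed.

Let P := ideal_quot null_ideal.

Fact root_seq_const n a : root_seq (fun m => a ^+ (p ^ (m - n))).
Proof. by exists n => m nm; rewrite subSn // expnSr exprM. Qed.

Let inS n (a : A) : S := sub_mk (root_seq_const n a).

Fact inS_additive n : zmod_morphism (inS n).
Proof.
by move=> x y; apply: val_inj; apply: funext => m; rewrite /= frobXB.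
Qed.
Fact inS_multiplicative n : monoid_morphism (inS n).
Proof.
split=> [|x y]; apply: val_inj; apply: funext => m; rewrite /= ?expr1n //.
by rewrite exprMn.
Qed.

Let inP n : {rmorphism A -> P} :=
  ideal_proj null_ideal \o rmorph_of (inS_additive n) (inS_multiplicative n).

Let proj_eq (s t : S) N : (forall n, (N <= n)%N -> ev s n = ev t n) ->
  ideal_proj null_ideal s = ideal_proj null_ideal t.
Proof.
move=> st; apply/eqP; rewrite -subr_eq0 -rmorphB; apply/eqP/ideal_proj_eq0.
exists N => n /st; rewrite /ev rmorphB => stn.
by rewrite opprfctE /= ?addrfctE [X in X - _]stn subrr.
Qed.

Let evX (s : S) N : (forall n, (N <= n)%N -> ev s n.+1 = ev s n ^+ p) ->
  forall n, (N <= n)%N -> ev s n = ev s N ^+ (p ^ (n - N)).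
Proof.
move=> sN n /subnKC <-; rewrite addKn; elim: (n - N)%N => [|k IH].
  by rewrite addn0 expr1.
by rewrite addnS sN ?leq_addr // IH -exprM expnSr.
Qed.

Let inP_surj (s : S) N : (forall n, (N <= n)%N -> ev s n.+1 = ev s n ^+ p) ->
  ideal_proj null_ideal s = inP N (ev s N).
Proof. by move=> sN; apply: (@proj_eq _ _ N) => n Nn; exact: (evX sN Nn). Qed.

Fact perfection_inS n a : inP n.+1 (a ^+ p) = inP n a.
Proof.
apply: (@proj_eq _ _ n.+1) => m nm.
change ((a ^+ p) ^+ (p ^ (m - n.+1)) = a ^+ (p ^ (m - n))).
by rewrite -exprM -expnS -subSn.
Qed.

Fact perfection_univ (B : comPzRingType) (g : nat -> {rmorphism A -> B}) :
    (forall n a, g n.+1 (a ^+ p) = g n a) ->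
    exists2 d : {rmorphism P -> B},
      (forall n a, d (inP n a) = g n a) &
      forall d' : {rmorphism P -> B},
        (forall n a, d' (inP n a) = g n a) -> d' =1 d.
Proof.
move=> gS; have gX n k a : g (n + k)%N (a ^+ (p ^ k)) = g n a.
  elim: k => [|k IH]; first by rewrite addn0 expr1.
  by rewrite addnS expnSr exprM gS IH.
pose N (s : S) := projT1 (cid (sub_inclP s)).
have NP s : forall n, (N s <= n)%N -> ev s n.+1 = ev s n ^+ p.
  exact: projT2 (cid (sub_inclP s)).
pose f s := g (N s) (ev s (N s)).
have fE (s : S) M : (N s <= M)%N -> f s = g M (ev s M).
  by move=> sM; rewrite (evX (@NP s) sM) -[in g M](subnKC sM) gX.
have fB : zmod_morphism f.
  move=> s t; pose M := maxn (N (s - t)) (maxn (N s) (N t)).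
  by rewrite !(@fE _ M) ?leq_max ?leqnn ?orbT // -rmorphB.
have fM : monoid_morphism f.
  split=> [|s t]; first by rewrite /f; apply: rmorph1.
  pose M := maxn (N (s * t)) (maxn (N s) (N t)).
  by rewrite !(@fE _ M) ?leq_max ?leqnn ?orbT // -rmorphM.
have [s [M s0]|d dE] := @ideal_quot_lift _ _ null_ideal _ (rmorph_of fB fM).
  by rewrite /= (@fE _ (maxn M (N s))) ?leq_maxr // s0 ?leq_maxl // rmorph0.
have dP n a : d (inP n a) = g n a.
  rewrite /= dE /= (@fE _ (maxn n (N (inS n a)))) ?leq_maxr //.
  rewrite /ev /= -[in g _](@subnKC n (maxn _ _)) ?leq_maxl ?gX //.
exists d => // d' d'P x; have [s ->] := ideal_proj_surj x.
by rewrite (inP_surj (@NP s)) d'P dP.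
Qed.

(** The universal property gives no direct hold on elements; the two clauses, read off the model,
    are what the descent from perfections to the original rings relies on. *)
Lemma perfection_exists : exists PA : perfection p A,
  (forall a, pf_in PA 0 a = 0 -> exists n, a ^+ (p ^ n) = 0) /\
  (forall x, exists n a, x = pf_in PA n a).
Proof.
exists (Perfection perfection_inS perfection_univ); split=> [a|x].
  move=> /ideal_proj_eq0[N /(_ N (leqnn N)) aN]; exists N.
  by rewrite -aN -[in LHS](subn0 N).
have [s ->] := ideal_proj_surj x; have [N sN] := sub_inclP s.
by exists N, (ev s N); rewrite (inP_surj sN).
Qed.
End PerfectionExists.

End Frobenius.

(** The universal property maps [D] into the subring cut out by [P]; followed by the inclusion, this
    map is the identity by uniqueness. *)
Lemma pushout_ind (A B C D : comPzRingType)
    (f : {rmorphism A -> B}) (g : {rmorphism A -> C})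
    (b : {rmorphism B -> D}) (c : {rmorphism C -> D}) (P : D -> Prop) :
  is_pushout f g b c -> subring P ->
  (forall x, P (b x)) -> (forall x, P (c x)) -> forall x, P x.
Proof.
move=> [bc univ] PR Pb Pc x.
pose PC := fun (x y : D) (_ : P x) (_ : P y) => mulrC x y.
have [y|d [db dc] _] := univ (sub_ring PR PC) (sub_lift PR PC Pb) (sub_lift PR PC Pc).
  by apply: sub_incl_inj; rewrite !sub_liftK bc.
have [d0 _ d0P] := univ _ b c bc.
have dx : sub_incl (d x) = x.
  rewrite (_ : sub_incl (d x) = d0 x); last first.
    apply: (d0P (sub_incl (PC:=PC) (PR:=PR) \o d)) => y /=.
      by rewrite db.
    by rewrite dc.
  by rewrite -(d0P idfun).
by rewrite -dx; apply: sub_inclP.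
Qed.

Lemma spec_eq (A : comPzRingType) (P Q : Spec A) : (forall x, P x <-> Q x) -> P = Q.
Proof.
case: P Q => [P pP] [Q pQ] /= PQ.
have {}PQ : P = Q by apply: funext => x; apply: propext.
by subst Q; congr MkSpec; apply: Prop_irrelevance.
Qed.

Lemma primeX (A : comPzRingType) (P : Spec A) x n : P (x ^+ n) -> P x.
Proof.
have [_ P1 PM] := pidealP P.
elim: n => [|n IH]; first by rewrite expr0 => /P1.
by rewrite exprS => /PM[//|/IH].
Qed.

Lemma prime_mulr (A : comPzRingType) (P : Spec A) x y : P x -> P (x * y).
Proof. by have [[_ _ PM] _ _] := pidealP P; rewrite mulrC; apply: PM. Qed.

Lemma primeXE (A : comPzRingType) (P : Spec A) x n : (0 < n)%N -> P (x ^+ n) <-> P x.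
Proof.
move=> n0; split; first exact: primeX.
by case: n n0 => // n _ Px; rewrite exprS; apply: prime_mulr.
Qed.

(** * Homeomorphisms of spectra from [p]-power roots *)

Section PowerHomeomorphism.
Variables (p : nat) (p_pr : prime p) (A B : comPzRingType) (f : {rmorphism A -> B}).
Hypothesis A_p : charp p A.
Hypothesis f_nil : forall a, f a = 0 -> exists n, a ^+ (p ^ n) = 0.
Hypothesis f_pow : forall b, exists n a, b ^+ (p ^ n) = f a.

Let pX n : (0 < p ^ n)%N.
Proof. by rewrite expn_gt0 prime_gt0. Qed.

Let prime_eq (P : Spec A) a a' : f a = f a' -> P a <-> P a'.
Proof.
have [[P0 PD _] _ _] := pidealP P; move=> faa.
have [|n] := @f_nil (a - a'); first by rewrite rmorphB faa subrr.
rewrite frobXB // => /eqP; rewrite subr_eq0 => /eqP an.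
by rewrite -(primeXE P a (pX n)) an primeXE.
Qed.

(** The only possible prime of [B] above [P]. The choice of [n] and [a] is immaterial, because two
    candidates for [a] differ, after suitable powers, by a nilpotent element. *)
Let up (P : Spec A) (b : B) : Prop := exists n a, b ^+ (p ^ n) = f a /\ P a.

Let upE (P : Spec A) b n a : b ^+ (p ^ n) = f a -> up P b <-> P a.
Proof.
move=> ba; split=> [[m [a' [ba' Pa']]]|Pa]; last by exists n, a.
rewrite -(primeXE P a (pX m)); have := Pa'; rewrite -(primeXE P a' (pX n)).
apply: (iffLR (prime_eq _ _)).
by rewrite !rmorphXn /= -ba -ba' -!exprM mulnC.
Qed.

Fact up_prime P : prime_ideal (up P : set B).
Proof.
have B_p := charp_map f A_p.
have [[P0 PD PM] P1 PP] := pidealP P.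
have com b b' : exists n a a', b ^+ (p ^ n) = f a /\ b' ^+ (p ^ n) = f a'.
  have [n [a ba]] := f_pow b; have [n' [a' ba']] := f_pow b'.
  exists (n + n')%N, (a ^+ (p ^ n')), (a' ^+ (p ^ n)).
  by rewrite !rmorphXn /= -ba -ba' -!exprM -!expnD addnC.
split.
- split.
  + by exists 0%N, 0; rewrite expr1 rmorph0.
  + move=> b b'; have [n [a [a' [ba ba']]]] := com b b'.
    rewrite (upE P ba) (upE P ba') => Pa Pa'.
    apply: (iffRL (upE P (n := n) (a := a + a') _)); last exact: PD.
    by rewrite frobXD // ba ba' rmorphD.
  + move=> b b'; have [n [a [a' [ba ba']]]] := com b b'.
    rewrite (upE P ba') => Pa'.
    apply: (iffRL (upE P (n := n) (a := a * a') _)); last exact: PM.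
    by rewrite exprMn ba ba' rmorphM.
- by rewrite (@upE P 1 0 1) // expr1 rmorph1.
- move=> b b'; have [n [a [a' [ba ba']]]] := com b b'.
  rewrite (upE P ba) (upE P ba') (@upE P (b * b') n (a * a')).
    exact: PP.
  by rewrite exprMn ba ba' rmorphM.
Qed.

Lemma power_homeomorphism : is_homeomorphism (spec_map f).
Proof.
exists (fun P => MkSpec (up_prime P)); split.
- move=> Q; apply: spec_eq => b /=; have [n [a ba]] := f_pow b.
  by rewrite (upE _ ba) /= -ba primeXE.
- by move=> P; apply: spec_eq => a /=; rewrite (@upE _ (f a) 0 a).
- apply/continuousP => _ [E ->]; exists [set f a | a in E]%classic.
  apply/seteqP; split=> Q /=.
    by move=> [a Ea Qa]; exists (f a) => //; exists a.
  by move=> [_ [a Ea <-] Qa]; exists a.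
- apply/continuousP => _ [E ->].
  (* [b] lies outside [up P] exactly when [a] lies outside [P], so the open set is defined by the
     elements of [A] whose image is a power of a defining element. *)
  exists [set a | exists n b, E b /\ b ^+ (p ^ n) = f a]%classic.
  apply/seteqP; split=> P /=.
    move=> [b Eb Pb]; have [n [a ba]] := f_pow b; exists a; first by exists n, b.
    by rewrite -(upE P ba).
  by move=> [a [n [b [Eb ba]]] Pa]; exists b => //; rewrite (upE P ba).
Qed.
End PowerHomeomorphism.

Section PerfectionHomeomorphism.
Variables (p : nat) (p_pr : prime p) (A B : comPzRingType) (f : {rmorphism A -> B}).
Hypotheses (A_p : charp p A) (f_iso : iso_on_perfections p f).

Let B_p : charp p B := charp_map f A_p.

Lemma pf_inX (C : comPzRingType) (PC : perfection p C) n k a :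
  pf_in PC (n + k)%N a ^+ (p ^ k) = pf_in PC n a.
Proof.
elim: k a => [|k IH] a; first by rewrite addn0 expr1.
by rewrite addnS expnS exprM -rmorphXn /= pf_inS.
Qed.

(** The preimage of [pf_in PB 0 b] has some finite level [n]. Its [p ^ n]-th power comes from level
    0, so [b ^+ (p ^ n)] and [f a] have the same image in the perfection of [B] and agree after a
    further power. *)
Lemma iso_on_perfections_pow b : exists n a, b ^+ (p ^ n) = f a.
Proof.
have [PA [_ PA_surj]] := perfection_exists p_pr A_p.
have [PB [PB_nil _]] := perfection_exists p_pr B_p.
have [fpf fpfE [g gK fK]] := f_iso PA PB.
have [n [a xa]] := PA_surj (g (pf_in PB 0 b)).
have := fK (pf_in PB 0 b); rewrite xa fpfE => /(congr1 (fun x => x ^+ (p ^ n))).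
rewrite -{1}[n]add0n pf_inX -rmorphXn => /eqP; rewrite eq_sym -subr_eq0 -rmorphB.
move=> /eqP/PB_nil[k] /=; rewrite frobXB // -exprM -expnD => /eqP.
by rewrite subr_eq0 -rmorphXn => /eqP; exists (n + k)%N, (a ^+ (p ^ k)).
Qed.

(** [B] maps to the perfection of [A'] through the inverse of the isomorphism of perfections,
    compatibly on [A] with the map coming from [A']. By the pushout property [pf_in PA' 0] then
    factors through [f'], and its kernel is nil. *)
Lemma iso_on_perfections_nil (A' B' : comPzRingType) (g : {rmorphism A -> A'})
    (g' : {rmorphism B -> B'}) (f' : {rmorphism A' -> B'}) :
  is_pushout f g g' f' -> forall a, f' a = 0 -> exists n, a ^+ (p ^ n) = 0.
Proof.
move=> [_ univ] a fa0; have A'_p := charp_map g A_p.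
have [PA _] := perfection_exists p_pr A_p.
have [PB _] := perfection_exists p_pr B_p.
have [PA' [PA'_nil _]] := perfection_exists p_pr A'_p.
have [fpf fpfE [r fK rK]] := f_iso PA PB.
have rB : zmod_morphism r.
  by move=> x y; apply: (can_inj fK); rewrite rmorphB !rK.
have rM : monoid_morphism r.
  by split=> [|x y]; apply: (can_inj fK); rewrite ?rmorph1 ?rmorphM !rK.
have [n x|h hE _] := @pf_univ _ _ PA PA' (fun n => pf_in PA' n \o g).
  by rewrite /= rmorphXn pf_inS.
have [x|d [_ dE] _] := univ PA' (h \o (rmorph_of rB rM \o pf_in PB 0)) (pf_in PA' 0).
  have := hE 0%N x; rewrite /= => <-; congr (h _).
  by apply: (can_inj fK); rewrite rK fpfE.
by apply: PA'_nil; rewrite -dE fa0 rmorph0.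
Qed.

Lemma iso_on_perfections_homeomorphism : universal_homeomorphism f.
Proof.
move=> A' B' g g' f' po; have A'_p := charp_map g A_p.
apply: (power_homeomorphism p_pr A'_p (iso_on_perfections_nil po)).
have B'_p := charp_map f' A'_p.
(* The elements with a power in the image of [f'] form a subring containing the images of [B] and
   [A']. *)
apply: (pushout_ind po).
- split=> [x y [n [a xa]] [m [b yb]]||x y [n [a xa]] [m [b yb]]].
  + exists (n + m)%N, (a ^+ (p ^ m) - b ^+ (p ^ n)).
    rewrite frobXB // rmorphB !rmorphXn /= -xa -yb -!exprM -!expnD.
    by rewrite (addnC m n).
  + by exists 0%N, 1; rewrite expr1 rmorph1.
  + exists (n + m)%N, (a ^+ (p ^ m) * b ^+ (p ^ n)).
    rewrite exprMn rmorphM !rmorphXn /= -xa -yb -!exprM -!expnD.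
    by rewrite (addnC m n).
- move=> b; have [n [a ba]] := iso_on_perfections_pow b.
  by exists n, (g a); rewrite -rmorphXn /= ba; case: po => ->.
- by move=> a; exists 0%N, a; rewrite expr1.
Qed.
End PerfectionHomeomorphism.

Lemma universal_homeomorphism_surjective (A B : comPzRingType)
    (f : {rmorphism A -> B}) : universal_homeomorphism f -> spec_surjective f.
Proof.
move=> /(_ A B idfun idfun f)[|g [_ gK _ _] P]; last by exists (g P).
split=> // E b c bc; exists b => //; split=> // x; exact: bc.
Qed.

(** * Polynomial covers and Dwork's congruences *)

Section MonomialEvaluation.
Variables (B : comNzRingType).

Definition cmonom_eval (m : cmonom B) : B := \prod_(b <- finsupp m) b ^+ m b.

Let cmonom_evalE (m : cmonom B) (d : {fset B}) :
  (finsupp m `<=` d)%fset -> cmonom_eval m = \prod_(b <- d) b ^+ m b.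
Proof.
move=> md; rewrite /cmonom_eval (big_fset_incl _ md) // => b _.
by rewrite -cmE_eq0 => /eqP ->.
Qed.

Fact cmonom_eval_morphism : mmorphism cmonom_eval.
Proof.
split=> [m m'|]; last by rewrite /cmonom_eval mdom1 big_nil.
rewrite (@cmonom_evalE m (finsupp (mul m m'))) ?mdomD ?fsubsetUl //.
rewrite (@cmonom_evalE m' (finsupp (mul m m'))) ?mdomD ?fsubsetUr //.
rewrite -big_split /cmonom_eval -mdomD; apply: eq_bigr => b _.
by rewrite cmM exprD.
Qed.
HB.instance Definition _ :=
  isMultiplicative.Build (cmonom B) B cmonom_eval cmonom_eval_morphism.

Lemma cmonom_evalU b : cmonom_eval (ucm b) = b.
Proof. by rewrite /cmonom_eval mdomU big_seq_fset1 cmUU. Qed.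

End MonomialEvaluation.

Definition torsionfree (O : comPzRingType) (pi : O) (B : alg O) :=
  forall x : B, alg_str B pi * x = 0 -> x = 0.

Lemma torsionfreeX (O : comPzRingType) (pi : O) (B : alg O) n (x : B) :
  torsionfree pi B -> alg_str B (pi ^+ n) * x = 0 -> x = 0.
Proof.
move=> Bpi; elim: n x => [|n IH] x; first by rewrite rmorph1 mul1r.
by rewrite exprS rmorphM -mulrA => /Bpi/IH.
Qed.

(* [B] is a quotient of the polynomial ring over [O] with variables indexed by
   [B]; the library requires [1 != 0] for that, whence the case distinction. *)
Lemma torsionfree_cover (O : idomainType) (pi : O) (B : alg O) : pi != 0 ->
  exists (F : alg O) (f : algHom F B),
    torsionfree pi F /\ forall b, exists x, f x = b.
Proof.
move=> pi0; have [B1|B1] := eqVneq (1 : B) 0.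
  have B0 (x y : B) : x = y by rewrite -[x]mul1r -[y]mul1r B1 !mul0r.
  exists (base_alg O), (alg_unit B); split=> [x /eqP|b]; last by exists 0.
  by rewrite mulf_eq0 (negPf pi0) => /eqP.
pose nz := GRing.PzSemiRing_isNonZero.Build (alg_ring B) B1.
pose B' : comNzRingType :=
  HB.pack_for comNzRingType (GRing.ComPzRing.sort (alg_ring B)) nz.
pose F := @Alg O {malg O[cmonom B']} (malgC : {rmorphism O -> {malg O[cmonom B']}}).
pose e : {rmorphism {malg O[cmonom B']} -> B'} :=
  mmap (alg_str B : {rmorphism O -> B'}) (@cmonom_eval B').
have eP c : e (alg_str F c) = alg_str B c by exact: mmapC.
exists F, (@AlgHom O F B e eP); split=> [x x0|b].
  apply/malgP => k; move/malgP/(_ k): x0.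
  rewrite mcoeffCM mcoeff0 => /eqP; rewrite mulf_eq0 (negPf pi0) => /eqP.
  exact.
exists (mkmalgU (ucm (b : B')) 1).
refine (etrans (@mmapU (cmonom B') O B' (alg_str B : {rmorphism O -> B'})
  (@cmonom_eval B') 1 (ucm (b : B'))) _).
rewrite cmonom_evalU -[RHS](mul1r (b : B')); congr (_ * _).
exact: (rmorph1 (alg_str B)).
Qed.

Definition eqto (A : Type) k (a b : nat -> A) := forall m, (m < k)%N -> a m = b m.

Section Ghost.
Variables (O : comPzRingType) (pi : O) (p h q : nat).
Hypotheses (p_pr : prime p) (h_gt0 : (0 < h)%N) (qE : q = (p ^ h)%N).
Variable c : O.
Hypothesis pE : p%:R = pi * c.

Let q_gt0 n : (0 < q ^ n)%N.
Proof. by rewrite qE -expnM expn_gt0 prime_gt0. Qed.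

Section Congruence.
Variable B : alg O.

Definition dvd_sub n (x y : B) := exists z, x - y = alg_str B (pi ^+ n) * z.

Lemma dvd_sub_refl n x : dvd_sub n x x.
Proof. by exists 0; rewrite subrr mulr0. Qed.

Lemma dvd_sub_weaken n m x y : (m <= n)%N -> dvd_sub n x y -> dvd_sub m x y.
Proof.
move=> /subnKC <- [z xy]; exists (alg_str B (pi ^+ (n - m)) * z).
by rewrite xy exprD rmorphM mulrA.
Qed.

Lemma dvd_subM n m w x y : dvd_sub n x y ->
  dvd_sub (m + n) (alg_str B (pi ^+ m) * w * x) (alg_str B (pi ^+ m) * w * y).
Proof.
by move=> [z xy]; exists (w * z); rewrite -mulrBr xy exprD rmorphM mulrACA.
Qed.

Lemma dvd_sub_sum n (I : Type) (r : seq I) (F G : I -> B) :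
  (forall i, dvd_sub n (F i) (G i)) ->
  dvd_sub n (\sum_(i <- r) F i) (\sum_(i <- r) G i).
Proof.
move=> FG; elim/big_ind2: _ => [|x x' y y' [z xz] [t yt]|i _] //.
  exact: dvd_sub_refl.
by exists (z + t); rewrite mulrDr -xz -yt addrACA opprD.
Qed.

(** Write [x = y + d]. The cross term of the expansion is a multiple of [p * d], and [d ^+ p] is a
    multiple of [d * d]; since [n > 0], both contain one factor [pi] more than [pi ^+ n]. *)
Lemma dvd_sub_frob n x y : (0 < n)%N -> dvd_sub n x y ->
  dvd_sub n.+1 (x ^+ p) (y ^+ p).
Proof.
move=> n0 [z /eqP]; rewrite subr_eq addrC => /eqP ->.
set d := alg_str B (pi ^+ n) * z.
have [t ->] := prime_exprD y d p_pr; rewrite /dvd_sub -2!addrA addrC addrA subrK.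
have [p' p'E] : exists p', p = p'.+2.
  by exists p.-2; case: p p_pr => [|[]].
have dE : d = alg_str B pi * (alg_str B (pi ^+ n.-1) * z).
  by rewrite mulrA -rmorphM -exprS prednK.
have pB : p%:R = alg_str B pi * alg_str B c by rewrite -rmorphM -pE rmorph_nat.
exists (z * (alg_str B (pi ^+ n.-1) * z) * d ^+ p' + alg_str B c * z * t).
rewrite pB [in X in d ^+ X]p'E !exprS rmorphM {2}dE.
by move: (d ^+ p') => dp; rewrite /d; ring.
Qed.

Lemma dvd_sub_frobX n k x y : (0 < n)%N -> dvd_sub n x y ->
  dvd_sub (n + k) (x ^+ (p ^ k)) (y ^+ (p ^ k)).
Proof.
move=> n0 xy; elim: k => [|k IH]; first by rewrite !expr1 addn0.
by rewrite addnS expnSr !exprM; apply: dvd_sub_frob => //; rewrite addn_gt0 n0.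
Qed.

Lemma dvd_sub_q n k x y : (0 < n)%N -> dvd_sub n x y ->
  dvd_sub (n + k) (x ^+ (q ^ k)) (y ^+ (q ^ k)).
Proof.
move=> n0 xy; rewrite qE -expnM.
apply: dvd_sub_weaken (dvd_sub_frobX (h * k) n0 xy).
by rewrite leq_add2l leq_pmull.
Qed.

Lemma ghost_recr (a : nat -> B) n : ghost pi q a n =
  \sum_(i < n) alg_str B (pi ^+ i) * a i ^+ (q ^ (n - i)) + alg_str B (pi ^+ n) * a n.
Proof. by rewrite /ghost big_ord_recr /= subnn expn0 expr1. Qed.

Lemma ghost_eqto k (a b : nat -> B) m :
  eqto k a b -> (m < k)%N -> ghost pi q a m = ghost pi q b m.
Proof.
move=> ab mk; apply: eq_bigr => i _; rewrite ab //.
by apply: leq_ltn_trans mk; rewrite -ltnS.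
Qed.

Lemma ghost0 n : ghost pi q (fun=> 0 : B) n = 0.
Proof.
rewrite /ghost big1 // => i _; rewrite expr0n.
by rewrite eqn0Ngt q_gt0 mulr0.
Qed.

Hypothesis B_tf : torsionfree pi B.

(** A converse to Dwork's congruences. If the earlier coordinates agree modulo [pi], their
    [q ^ (n - i)]-th powers agree modulo [pi ^+ (n - i).+1], so all ghost terms but the last agree
    modulo [pi ^+ n.+1]; torsion freeness cancels [pi ^+ n] from the last. *)
Lemma ghost_dvd_sub N (a b : nat -> B) :
  (forall n, (n < N)%N -> dvd_sub n.+1 (ghost pi q a n) (ghost pi q b n)) ->
  forall n, (n < N)%N -> dvd_sub 1 (a n) (b n).
Proof.
move=> ab; elim/ltn_ind => n IH nN; have := ab n nN; rewrite !ghost_recr.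
set s := \sum_(i < n) _; set t := \sum_(i < n) _.
have [w st] : dvd_sub n.+1 s t.
  apply: dvd_sub_sum => i; rewrite -[alg_str B _]mulr1.
  rewrite -[n.+1](@subnKC i) 1?ltnW // 1?ltnS 1?ltnW //.
  apply: dvd_subM; rewrite subSn 1?ltnW // -add1n; apply: dvd_sub_q => //.
  by apply: IH => //; apply: ltn_trans nN.
move=> [z /eqP]; rewrite opprD addrACA st eq_sym addrC -subr_eq -mulrBr -mulrBr.
rewrite exprSr rmorphM -mulrA -subr_eq0 -mulrBr => /eqP.
move=> /(torsionfreeX B_tf)/eqP; rewrite subr_eq0 => /eqP e.
by exists (z - w); rewrite expr1.
Qed.

Lemma ghost_inj k (a b : nat -> B) :
  (forall m, (m < k)%N -> ghost pi q a m = ghost pi q b m) -> eqto k a b.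
Proof.
move=> ab; elim/ltn_ind => n IH nk; have := ab n nk; rewrite !ghost_recr.
rewrite (eq_bigr (fun i : 'I_n => alg_str B (pi ^+ i) * b i ^+ (q ^ (n - i)))).
  move/addrI/eqP; rewrite -subr_eq0 -mulrBr => /eqP /(torsionfreeX B_tf)/eqP.
  by rewrite subr_eq0 => /eqP.
by move=> i _; rewrite IH //; apply: ltn_trans nk.
Qed.
End Congruence.
End Ghost.

(** * Ramified Witt vectors *)

Section WittLift.
Variables (O : idomainType) (pi : O) (p h q : nat).
Hypotheses (p_pr : prime p) (h_gt0 : (0 < h)%N) (qE : q = (p ^ h)%N).
Variable c : O.
Hypotheses (pE : p%:R = pi * c) (pi_neq0 : pi != 0).
Variable W : wittVectors pi q.

Lemma witt_ext (B : alg O) (x y : witt W B) : wcoef x =1 wcoef y -> x = y.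
Proof. by move=> xy; apply: funext. Qed.

Lemma wcoef_map (B C : alg O) (f : algHom B C) (x : witt W B) n :
  wcoef (rmap (witt W) f x) n = f (wcoef x n).
Proof. exact: witt_mapE. Qed.

Definition wmk (B : alg O) (a : nat -> B) : witt W B := a.

Lemma wcoef_mk (B : alg O) (a : nat -> B) : wcoef (wmk a) = a. Proof. by []. Qed.

Definition ghostW (B : alg O) n (x : witt W B) : B := witt_ghost W B n x.

Lemma ghostWE (B : alg O) n (x : witt W B) : ghostW n x = ghost pi q (wcoef x) n.
Proof. exact: witt_ghostE. Qed.

Lemma ghostWD (B : alg O) n (x y : witt W B) :
  ghostW n (x + y) = ghostW n x + ghostW n y.
Proof. exact: rmorphD. Qed.

Lemma ghostWM (B : alg O) n (x y : witt W B) :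
  ghostW n (x * y) = ghostW n x * ghostW n y.
Proof. exact: rmorphM. Qed.

Lemma ghostW0 (B : alg O) n : ghostW n (0 : witt W B) = 0.
Proof. exact: rmorph0. Qed.

Lemma ghostW_str (B : alg O) n a : ghostW n (witt_str W B a) = alg_str B a.
Proof. exact: witt_ghost_str. Qed.

(** The lift is a set-theoretic section applied coordinate by coordinate. It need not respect the
    ring operations, but it keeps the agreement of initial coordinates, which is what the truncation
    arguments use. *)
Lemma witt_lift (B : alg O) : exists (F : alg O) (f : algHom F B)
    (s : (nat -> B) -> witt W F),
  [/\ torsionfree pi F,
      forall x : witt W B, rmap (witt W) f (s (wcoef x)) = x &
      forall k a b, eqto k a b -> eqto k (wcoef (s a)) (wcoef (s b))].
Proof.
have [F [f [F_tf f_surj]]] := torsionfree_cover B pi_neq0.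
have [s sK] := choice f_surj.
exists F, f, (fun a => wmk (s \o a)); split=> // [x|k a b ab m /ab abm].
  by apply: witt_ext => n; rewrite wcoef_map wcoef_mk /= sK.
by rewrite !wcoef_mk /= abm.
Qed.

Lemma eqto_map k (B C : alg O) (f : algHom B C) (x y : witt W B) :
  eqto k (wcoef x) (wcoef y) ->
  eqto k (wcoef (rmap (witt W) f x)) (wcoef (rmap (witt W) f y)).
Proof. by move=> xy m mk; rewrite !wcoef_map xy. Qed.

(** The ring structure is given abstractly, so even the coordinates of zero have to be recovered
    from ghost components over a torsion free cover. *)
Lemma wcoef0 (B : alg O) n : wcoef (0 : witt W B) n = 0.
Proof.
have [F [f [s [F_tf _ _]]]] := witt_lift B.
suff e : wcoef (0 : witt W F) n = 0 by rewrite -(rmorph0 (rmap _ f)) wcoef_map e rmorph0.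
apply: (@ghost_inj _ _ q _ F_tf n.+1 (wcoef (0 : witt W F)) (fun=> 0)) => // m _.
by rewrite -ghostWE ghostW0 (ghost0 _ p_pr qE).
Qed.

Section Eqto.
Variables (B : alg O) (k : nat).
Implicit Types x y z : witt W B.

Lemma eqto_addr x y z : eqto k (wcoef x) (wcoef y) ->
  eqto k (wcoef (x + z)) (wcoef (y + z)).
Proof.
have [F [f [s [F_tf sK sE]]]] := witt_lift B => xy.
rewrite -[x]sK -[y]sK -[z]sK -!rmorphD; apply/eqto_map/(ghost_inj (q := q) F_tf) => m mk.
rewrite -!ghostWE !ghostWD !ghostWE; congr (_ + _).
exact: ghost_eqto (sE _ _ _ xy) mk.
Qed.

Lemma eqto_mulr x y z : eqto k (wcoef x) (wcoef y) ->
  eqto k (wcoef (x * z)) (wcoef (y * z)).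
Proof.
have [F [f [s [F_tf sK sE]]]] := witt_lift B => xy.
rewrite -[x]sK -[y]sK -[z]sK -!rmorphM; apply/eqto_map/(ghost_inj (q := q) F_tf) => m mk.
rewrite -!ghostWE !ghostWM !ghostWE; congr (_ * _).
exact: ghost_eqto (sE _ _ _ xy) mk.
Qed.

(** This is [V ^ k W]. Comparing with the coordinates of zero lets the ideal laws follow directly
    from [eqto_addr] and [eqto_mulr]. *)
Definition wnull x := eqto k (wcoef x) (wcoef (0 : witt W B)).

Lemma wnull_sub x y : wnull (x - y) <-> eqto k (wcoef x) (wcoef y).
Proof.
split=> xy; first by have := eqto_addr y xy; rewrite subrK add0r.
by have := eqto_addr (- y) xy; rewrite subrr.
Qed.

Lemma wnullP x : wnull x <-> forall m, (m < k)%N -> wcoef x m = 0.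
Proof. by split=> x0 m /x0; rewrite wcoef0. Qed.

Lemma wnull_ideal : ideal (wnull : set (witt W B)).
Proof.
split=> [|x y x0 y0|a x x0]; first by [].
  by have := eqto_addr y x0; rewrite add0r /wnull => xy m mk; rewrite xy // y0.
by have := eqto_mulr a x0; rewrite mul0r mulrC.
Qed.

Lemma wnull0 : wnull 0. Proof. by have [] := wnull_ideal. Qed.
Lemma wnullM a x : wnull x -> wnull (a * x).
Proof. by have [_ _] := wnull_ideal; apply. Qed.
Lemma wnullD x y : wnull x -> wnull y -> wnull (x + y).
Proof. by have [_ + _] := wnull_ideal; apply. Qed.
Lemma wnull_sum I (r : seq I) (F : I -> witt W B) :
  (forall i, wnull (F i)) -> wnull (\sum_(i <- r) F i).
Proof. by move=> F0; elim/big_ind: _ => //; exact: wnullD. Qed.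
End Eqto.

Lemma wnull_all (B : alg O) (x : witt W B) : (forall k, wnull k x) -> x = 0.
Proof. by move=> x0; apply: witt_ext => n; apply: x0 (ltnSn n). Qed.

Let q_neq0 n : (q ^ n == 0)%N = false.
Proof. by rewrite qE -expnM expn_eq0 (negPf (lt0n_neq0 (prime_gt0 p_pr))). Qed.

Section Special.
Variable B : alg O.
Hypothesis B_pi : alg_str B pi = 0.

(** Multiplication by [pi] is Verschiebung after the [q]-Frobenius. For the lift [X], the ghost
    component [m] of [pi] times [X] exceeds that of the shifted vector [Y] by exactly [pi ^+ m.+1]
    times [wcoef X m], so the coordinates agree modulo [pi], which is zero in [B]. *)
Lemma wcoef_pi (x : witt W B) n : wcoef (witt_str W B pi * x) n =
  if n is m.+1 then wcoef x m ^+ q else 0.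
Proof.
have [F [f [s [F_tf sK sE]]]] := witt_lift B.
rewrite -[in LHS](sK x); set X := s (wcoef x).
have -> : witt_str W B pi = rmap (witt W) f (witt_str W F pi).
  by rewrite [RHS](witt_map_str W f).
pose Y := wmk (fun n => if n is m.+1 then wcoef X m ^+ q else 0).
have YE n' : wcoef Y n' = if n' is m.+1 then wcoef X m ^+ q else 0 by [].
rewrite -rmorphM wcoef_map.
have D m : dvd_sub pi m.+1 (ghost pi q (wcoef (witt_str W F pi * X)) m)
    (ghost pi q (wcoef Y) m).
  rewrite -!ghostWE ghostWM ghostW_str !ghostWE ghost_recr.
  exists (wcoef X m); rewrite /ghost big_ord_recl YE expr0n.
  rewrite q_neq0 mulr0 add0r mulrDr addrAC mulr_sumr.
  rewrite (eq_bigr (fun i : 'I_m => alg_str F (pi ^+ lift ord0 i) *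
      wcoef Y (lift ord0 i) ^+ (q ^ (m - lift ord0 i)))).
    by rewrite subrr add0r mulrA -rmorphM -exprS.
  move=> i _; rewrite lift0 YE exprS rmorphM -mulrA.
  by rewrite -exprM -expnS -subSn ?subSS.
have [z] := ghost_dvd_sub p_pr h_gt0 qE pE F_tf
  (fun m (_ : (m < n.+1)%N) => D m) (ltnSn n).
rewrite expr1 => /eqP; rewrite subr_eq => /eqP ->.
rewrite rmorphD rmorphM alg_homP B_pi mul0r add0r.
have <- := congr1 (fun y => if n is m.+1 then wcoef y m ^+ q else 0) (sK x).
by case: (n) => [|m]; rewrite YE ?rmorph0 // wcoef_map rmorphXn.
Qed.

Lemma wcoef_piX (x : witt W B) k n : wcoef (witt_str W B (pi ^+ k) * x) n =
  if (k <= n)%N then wcoef x (n - k) ^+ (q ^ k) else 0.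
Proof.
elim: k n => [|k IH] n; first by rewrite rmorph1 mul1r subn0 expn0 expr1.
rewrite exprS rmorphM -mulrA wcoef_pi; case: n => // n.
rewrite IH ltnS subSS; case: ifP => _; last first.
  by rewrite expr0n -(expn1 q) q_neq0.
by rewrite -exprM -expnSr.
Qed.

Lemma wnull_piX k (x : witt W B) : wnull k (witt_str W B (pi ^+ k) * x).
Proof. by apply/wnullP => m mk; rewrite wcoef_piX leqNgt mk. Qed.

Hypothesis B_perf : perfect p B.

(** Dividing by [pi ^+ k] means shifting back and extracting [q ^ k]-th roots of the coordinates,
    which is where perfectness enters. *)
Lemma wnull_piXP k (x : witt W B) : wnull k x ->
  exists y, x = witt_str W B (pi ^+ k) * y.
Proof.
move=> /wnullP x0.
have [y yE] := choice (fun n => perfectX_root (h * k) (wcoef x (n + k)) B_perf).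
exists (wmk y); apply: witt_ext => n; rewrite wcoef_piX wcoef_mk.
have -> : (q ^ k = p ^ (h * k))%N by rewrite qE expnM.
by case: leqP => [kn|/x0 //]; rewrite -yE subnK.
Qed.

Lemma witt_pi_reg (x : witt W B) : witt_str W B pi * x = 0 -> x = 0.
Proof.
move=> px0; apply: witt_ext => n; rewrite wcoef0.
have := congr1 (fun y => wcoef y n.+1) px0; rewrite /= wcoef_pi wcoef0 => xq.
by apply: (perfectX0 (n := h) B_perf); rewrite -qE.
Qed.
End Special.

End WittLift.

(** * Expansions along powers of the uniformizer *)

Section RowSum.
Variables (S T : comPzRingType) (phi : {rmorphism S -> T}) (t : T) (e : nat).

(** An expansion with [e] digits in powers of [t]. It is used for [j] in [O], for [greenberg_l] in
    the Greenberg algebra and for Drinfeld's map in the ramified Witt vectors. *)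
Definition row_sum (x : 'rV[S]_e) : T := \sum_i phi (x 0 i) * t ^+ i.

Lemma row_sumD x y : row_sum (x + y) = row_sum x + row_sum y.
Proof.
by rewrite -big_split; apply: eq_bigr => i _; rewrite mxE rmorphD mulrDl.
Qed.

Lemma row_sumZ a x : row_sum (a *: x) = phi a * row_sum x.
Proof.
by rewrite mulr_sumr; apply: eq_bigr => i _; rewrite mxE rmorphM mulrA.
Qed.

Lemma row_sumB x y : row_sum (x - y) = row_sum x - row_sum y.
Proof. by rewrite row_sumD -scaleN1r row_sumZ rmorphN1 mulN1r. Qed.

Lemma row_sum_basis i : row_sum (delta_mx 0 i) = t ^+ i.
Proof.
rewrite /row_sum (bigD1 i) //= mxE !eqxx rmorph1 mul1r big1 ?addr0 // => k ki.
by rewrite mxE (negPf ki) andbF rmorph0 mul0r.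
Qed.
End RowSum.
Arguments row_sum {S T} phi t {e} x.

Section PTypical.
Variables (p : nat) (p_pr : prime p) (W : wittVectors (p%:Z) p).
Variable A : comPzRingType.
Local Notation S := (witt W (Zalg A)).

Let qE : p = (p ^ 1)%N. Proof. by rewrite expn1. Qed.
Let pE : p%:R = p%:Z * 1. Proof. by rewrite mulr1 natz. Qed.
Let p_neq0 : p%:Z != 0. Proof. by rewrite eqz_nat -lt0n prime_gt0. Qed.

Lemma witt_str_int (a : int) : witt_str W (Zalg A) a = a%:~R :> S.
Proof. by rewrite -[in LHS](intz a) rmorph_int. Qed.

Let pX k : p%:R ^+ k = witt_str W (Zalg A) (p%:Z ^+ k) :> S.
Proof. by rewrite rmorphXn; congr (_ ^+ _); rewrite witt_str_int. Qed.

Hypothesis A_p : charp p A.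

Let A_p' : alg_str (Zalg A) p%:Z = 0.
Proof. exact: A_p. Qed.

Lemma wnull_pX k (x : S) : wnull k (p%:R ^+ k * x).
Proof. by rewrite pX; apply: (wnull_piX p_pr _ qE pE p_neq0). Qed.

Lemma wnull_p_mul k (x : S) : wnull k x -> wnull k.+1 (p%:R * x).
Proof.
move=> /(wnullP p_pr qE p_neq0) x0; apply/(wnullP p_pr qE p_neq0) => m mk.
have := pX 1; rewrite !expr1 => ->.
rewrite (wcoef_pi p_pr _ qE pE p_neq0) //; case: m mk => // m mk.
by rewrite x0 // expr0n; case: p p_pr.
Qed.

Lemma wnull_pXP k (x : S) : perfect p A -> wnull k x -> exists y, x = p%:R ^+ k * y.
Proof. by move=> A_perf; rewrite pX; apply: (wnull_piXP p_pr _ qE pE p_neq0). Qed.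

Hypothesis A_perf : perfect p A.
Variables (T : comPzRingType) (phi : {rmorphism S -> T}) (t v v' : T) (e : nat).
Hypotheses (e_gt0 : (0 < e)%N) (vv' : v * v' = 1) (pT : p%:R = v * t ^+ e).
Hypotheses (t_reg : forall x, t * x = 0 -> x = 0).

Let tX_reg k x : t ^+ k * x = 0 -> x = 0.
Proof.
elim: k => [|k IH]; first by rewrite mul1r.
by rewrite exprS -mulrA => /t_reg/IH.
Qed.

Let tX_inj k x y : t ^+ k * x = t ^+ k * y -> x = y.
Proof.
by move/eqP; rewrite -subr_eq0 -mulrBr => /eqP/tX_reg/eqP; rewrite subr_eq0 => /eqP.
Qed.

Section Injective.
Hypothesis phi_inj : forall x y, phi x = t * y -> wcoef x 0 = 0.

Let wnull1 x : wcoef x 0 = 0 -> exists y : S, x = p%:R * y.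
Proof.
move=> x0; have [|y ->] := @wnull_pXP 1 x A_perf; last by exists y; rewrite expr1.
by apply/(wnullP p_pr qE p_neq0) => -[].
Qed.

(** Isolate the digit [i]: the earlier ones are multiples of [p], hence of [t ^+ e], and the later
    ones carry [t ^+ i.+1]. Cancelling [t ^+ i] leaves [phi (x 0 i)] divisible by [t]. *)
Let digit0 (x : 'rV[S]_e) y : row_sum phi t x = t ^+ e * y ->
  forall n (i : 'I_e), (i < n)%N -> wcoef (x 0 i) 0 = 0.
Proof.
move=> xy; elim=> // n IH i; rewrite ltnS leq_eqVlt => /orP[/eqP iE|]; last exact: IH.
suff [z xz] : exists z, phi (x 0 i) = t * z by apply: phi_inj xz.
suff [z] : exists z, row_sum phi t x - t ^+ i * phi (x 0 i) = t ^+ i.+1 * z.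
  have te : t ^+ e = t ^+ i * (t * t ^+ (e - i.+1)).
    by rewrite -exprS -exprD -subSn // subSS subnKC // ltnW.
  rewrite xy te => xyz; exists (t ^+ (e - i.+1) * y - z); apply: (@tX_inj i).
  rewrite (_ : t ^+ i * (t * _) =
    t ^+ i * (t * t ^+ (e - i.+1)) * y - t ^+ i.+1 * z); last by rewrite exprS; ring.
  by rewrite -xyz; ring.
rewrite /row_sum (bigD1 i) //= (mulrC (phi (x 0 i))) (addrC (t ^+ i * _)) addrK.
elim/big_ind: _ => [|a b [z ->] [z' ->]|k ki].
- by exists 0; rewrite mulr0.
- by exists (z + z'); rewrite mulrDr.
have [ik|ki'|/val_inj ik] := ltngtP i k; last by rewrite ik eqxx in ki.
  by exists (phi (x 0 k) * t ^+ (k - i.+1)); rewrite mulrCA -exprD subnKC.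
have [|y' ->] := @wnull1 (x 0 k); first by apply: IH; rewrite -iE.
rewrite rmorphM rmorph_nat pT; exists (v * t ^+ (e - i.+1) * phi y' * t ^+ k).
have -> : t ^+ e = t ^+ i.+1 * t ^+ (e - i.+1) by rewrite -exprD subnKC.
by ring.
Qed.

(** All entries are multiples of [p] by [digit0]; dividing the row by [p], a unit times [t ^+ e],
    lowers [k] by one. Taking [y = 0] gives injectivity, while general [y] serves the truncated
    kernels. *)
Lemma row_sum_strict k (x : 'rV[S]_e) y : row_sum phi t x = t ^+ (e * k) * y ->
  forall i, wnull k (x 0 i).
Proof.
elim: k x y => [|k IH] x y; first by move=> _ i m.
rewrite mulnS exprD -mulrA => xy i.
have /choice[y' y'E] : forall i, exists y, x 0 i = p%:R * y.
  by move=> l; apply: wnull1; apply: digit0 xy _ _ (ltn_ord l).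
rewrite y'E; apply: wnull_p_mul.
have -> : y' i = (\row_i y' i) 0 i by rewrite mxE.
apply: (IH _ (v' * y)); apply: (@tX_inj e).
have xE : x = p%:R *: \row_i y' i by apply/rowP => l; rewrite !mxE y'E.
move: xy; rewrite xE row_sumZ rmorph_nat pT => xy.
rewrite -[LHS]mul1r -vv' -mulrA mulrCA (mulrA _ _ (row_sum phi t _)) xy.
by rewrite mulrCA (mulrCA v').
Qed.

Lemma row_sum_inj : injective (row_sum phi t : 'rV[S]_e -> T).
Proof.
move=> x y /eqP; rewrite -subr_eq0 -row_sumB => /eqP xy.
apply/rowP => i; apply/eqP; rewrite -subr_eq0; apply/eqP.
have -> : x 0 i - y 0 i = (x - y) 0 i by rewrite !mxE.
apply: wnull_all => k.
by apply: (@row_sum_strict k _ 0); rewrite xy mulr0.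
Qed.
End Injective.

Section Surjective.
Hypothesis t_sep : forall x, (forall k, exists y, x = t ^+ k * y) -> x = 0.
Hypothesis phi_surj : forall z, exists x y, z = phi x + t * y.

Let digits z : exists (x : 'rV[S]_e) z', z = row_sum phi t x + p%:R * z'.
Proof.
suff [x [z' ->]] : exists (x : nat -> S) z',
    z = \sum_(i < e) phi (x i) * t ^+ i + t ^+ e * z'.
  exists (\row_i x i), (v' * z'); congr (_ + _).
    by apply: eq_bigr => i _; rewrite mxE.
  by rewrite pT mulrACA vv' mul1r.
elim: e => [|n [x [z' ->]]].
  by exists (fun=> 0), z; rewrite big_ord0 add0r mul1r.
have [a [y ->]] := phi_surj z'.
exists (fun i => if (i < n)%N then x i else a), y.
rewrite big_ord_recr /= ltnn exprSr mulrDr addrA mulrA; congr (_ + _ + _).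
  by apply: eq_bigr => i _; rewrite ltn_ord.
exact: mulrC.
Qed.

Lemma row_sum_surj z : exists x : 'rV[S]_e, z = row_sum phi t x.
Proof.
have [d dE] := choice digits; have [r rE] := choice dE.
(* [z_ k] is the remainder after [k] rounds of extracting digits, and [X k] collects the digits
   found so far. *)
pose z_ k := iter k r z; pose X k := \sum_(l < k) p%:R ^+ l *: d (z_ l).
have zE k : z = row_sum phi t (X k) + p%:R ^+ k * z_ k.
  elim: k => [|k IH].
    rewrite /X big_ord0 mul1r -[0](subrr 0) row_sumB subrr add0r //.
  rewrite {1}IH {1}[z_ k]rE /X big_ord_recr /= row_sumD row_sumZ rmorphXn rmorph_nat.
  by rewrite mulrDr addrA mulrA -exprSr.
have XS k m i : wnull k (X (k + m)%N 0 i - X k 0 i).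
  elim: m => [|m IH]; first by rewrite addn0 subrr; apply: (wnull0 p_neq0).
  rewrite addnS /X big_ord_recr /= mxE addrAC.
  apply: (wnullD p_neq0) IH _; rewrite mxE exprD -mulrA.
  exact: wnull_pX.
(* The entries of [X k] are stable modulo [V ^ k] from [k] on, so the limit is taken diagonally,
   coordinate [m] being read in [X m.+1]. *)
pose L := \row_i (wmk W (fun m => wcoef (X m.+1 0 i) m) : S).
have LX k i : wnull k (L 0 i - X k 0 i).
  apply/(wnull_sub p_neq0) => m mk; rewrite mxE wcoef_mk.
  have /(wnull_sub p_neq0)/(_ m (ltnSn m)) := XS m.+1 (k - m.+1)%N i.
  by rewrite subnKC.
exists L; apply/eqP; rewrite -subr_eq0; apply/eqP; apply: t_sep => k.
have /choice[y yE] : forall i, exists y, L 0 i - X k 0 i = p%:R ^+ k * y.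
  by move=> i; apply: wnull_pXP.
have {}yE : L = X k + p%:R ^+ k *: \row_i y i.
  by apply/rowP => i; rewrite !mxE -yE mxE addrC subrK.
rewrite {1}(zE k) yE row_sumD row_sumZ rmorphXn rmorph_nat.
rewrite opprD addrACA subrr add0r -mulrBr pT exprMn -exprM.
(* Separation needs only a factor [t ^+ k], which [t ^+ (e * k)] contains because [e > 0]. *)
have -> : t ^+ (e * k) = t ^+ k * t ^+ (e.-1 * k) by rewrite -exprD -mulSn prednK.
by rewrite mulrCA -mulrA; eexists.
Qed.
End Surjective.
End PTypical.

(** * Complete discrete valuation rings *)

Section DVR.
Variables (O : idomainType) (pi : O).
Hypotheses (O_dvr : is_dvr O) (pi_unif : is_uniformizer pi).

Lemma principalP (a x : O) : principal a x <-> exists y, x = a * y.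
Proof. by split=> [[y _ <-]|[y ->]]; exists y. Qed.

Lemma uniformizer_neq0 : pi != 0.
Proof. by case: pi_unif. Qed.

(** The intersection of the ideals generated by the [pi ^+ k] is generated by some [d], and
    [d = pi * d'] with [d'] again in it, since [pi] is regular. So [d = pi * t * d], and [d != 0]
    would make [pi] a unit. *)
Lemma uniformizer_sep (x : O) : (forall k, exists y, x = pi ^+ k * y) -> x = 0.
Proof.
pose J : set O := fun x => forall k, exists y, x = pi ^+ k * y.
have [pid _] := O_dvr.
have [|d Jd] := pid J.
  split=> [k|y z Jy Jz k|a y Jy k]; first by exists 0; rewrite mulr0.
    have [[y' ->] [z' ->]] := conj (Jy k) (Jz k).
    by exists (y' + z'); rewrite mulrDr.
  by have [y' ->] := Jy k; exists (a * y'); rewrite mulrCA.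
have {}Jd y : J y <-> exists z, y = d * z by rewrite Jd principalP.
have Jdd : J d by apply/Jd; exists 1; rewrite mulr1.
have [d' d'E] := Jdd 1; rewrite expr1 in d'E.
have /Jd[t d't] : J d'.
  move=> k; have [y dy] := Jdd k.+1; exists y.
  by apply: (mulfI uniformizer_neq0); rewrite -d'E dy exprS mulrA.
suff d0 : d = 0 by move=> /Jd[z ->]; rewrite d0 mul0r.
apply/eqP; apply: contraT => d_neq0; case: pi_unif => -[_ pi1 _] _; case: pi1.
apply/principalP; exists t; apply: (mulfI d_neq0).
by rewrite mulr1 {1}d'E d't mulrCA.
Qed.

Section Residue.
Variables (kappa : fieldType) (res : {rmorphism O -> kappa}).
Hypotheses (O_complete : adically_complete pi) (res_residue : is_residue_map pi res).

Lemma residue_eq0 x : res x = 0 <-> exists y, x = pi * y.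
Proof. by have [_ ->] := res_residue; exact: principalP. Qed.

Lemma residue_unit x : res x != 0 -> exists y, x * y = 1.
Proof.
move=> x0; have [res_surj _] := res_residue.
have [y yE] := res_surj (res x)^-1.
have /residue_eq0[c cE] : res (1 - x * y) = 0.
  by rewrite rmorphB rmorph1 rmorphM yE divff // subrr.
(* Partial sums of the geometric series, whose limit [l] inverts [x * y = 1 - pi * c]. *)
pose S n := \sum_(i < n) (pi * c) ^+ i.
have SE n : S n * (x * y) = 1 - (pi * c) ^+ n.
  apply: oppr_inj; rewrite opprB subrX1 -mulrN mulrC.
  by rewrite -[x * y](subKr 1) cE opprB.
have [|l lP] := O_complete (x := S).
  move=> n; exists n => i j.
  wlog : i j / (i <= j)%N => [IH ni nj|ij ni _].
    have [/IH|/ltnW/IH] := leqP i j; first exact.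
    move=> /(_ nj ni)/principalP[z zE]; apply/principalP.
    by exists (- z); rewrite mulrN -zE opprB.
  apply/principalP; rewrite -(subnKC ij) /S big_split_ord /= opprD addrA subrr sub0r.
  exists (- (pi ^+ (i - n) * c ^+ i * \sum_(k < j - i) (pi * c) ^+ k)).
  rewrite mulrN !mulrA -exprD subnKC // -exprMn mulr_sumr; congr (- _).
  by apply: eq_bigr => k _; rewrite exprD.
exists (y * l); rewrite mulrA; apply/eqP; rewrite eq_sym -subr_eq0; apply/eqP.
apply: uniformizer_sep => k; have [N /(_ (maxn N k) (leq_maxl _ _))] := lP k.
set i := maxn N k => /principalP[z zE].
have -> : 1 - x * y * l = (pi * c) ^+ i + (S i - l) * (x * y).
  by rewrite mulrBl SE addrA [(pi * c) ^+ i + _]addrC subrK (mulrC l).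
have -> : (pi * c) ^+ i = pi ^+ k * (c ^+ k * (pi * c) ^+ (i - k)).
  by rewrite mulrA -exprMn -exprD subnKC // leq_maxr.
by rewrite zE -mulrA -mulrDr; eexists.
Qed.

Lemma uniformizer_val x : x != 0 -> exists e v v',
  v * v' = 1 /\ x = v * pi ^+ e.
Proof.
move=> x0; have [k0 k0P] : exists k, ~ exists y, x = pi ^+ k * y.
  apply/existsNP => xk; move/eqP: x0; apply; apply: uniformizer_sep => k.
  exact: xk.
have {k0P} [e []] : exists e,
    (exists y, x = pi ^+ e * y) /\ ~ exists y, x = pi ^+ e.+1 * y.
  elim: k0 k0P => [[]|k IH kP]; first by exists x; rewrite mul1r.
  have [xk|] := EM (exists y, x = pi ^+ k * y); first by exists k.
  exact: IH.
move=> [v ->] ve; have [|v' vv'] := @residue_unit v.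
  apply/eqP => /residue_eq0[y yE]; apply: ve; exists y.
  by rewrite yE exprSr mulrA.
by exists e, v, v'; split=> //; rewrite mulrC.
Qed.
End Residue.
End DVR.

Lemma char0_prime_neq0 (O : idomainType) p :
  [pchar {fraction O}] =i pred0 -> prime p -> p%:R != 0 :> O.
Proof.
move=> O0 p_pr; apply/eqP => p0; have := O0 p; rewrite !inE p_pr /=.
by rewrite -(rmorph_nat (@FracField.tofrac O)) p0 rmorph0 eqxx.
Qed.

(** * Base change of a basis along a pushout *)

Section PushoutBasis.
Variables (S0 S O R : comPzRingType) (f : {rmorphism S0 -> S}) (j : {rmorphism S0 -> O}).
Variables (b : {rmorphism S -> R}) (c : {rmorphism O -> R}).
Hypothesis po : is_pushout f j b c.
Variables (t : O) (e : nat).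
Hypotheses (j_inj : injective (row_sum j t : 'rV[S0]_e -> O)).
Hypotheses (j_surj : forall l, exists x : 'rV[S0]_e, l = row_sum j t x).

(** Expansions are closed under products because a power of [t] of any exponent lies in [O], where
    [j_surj] expands it again. *)
Lemma pushout_row_sum_surj r : exists x : 'rV[S]_e, r = row_sum b (c t) x.
Proof.
pose P (r : R) := exists x : 'rV[S]_e, r = row_sum b (c t) x.
have PB x y : P x -> P y -> P (x - y).
  by move=> [x' ->] [y' ->]; exists (x' - y'); rewrite row_sumB.
have Pc l : P (c l).
  have [x ->] := j_surj l; exists (map_mx f x).
  rewrite rmorph_sum; apply: eq_bigr => i _; rewrite mxE rmorphM rmorphXn.
  by case: po => ->.
have P0 : P 0 by exists (0 - 0); rewrite row_sumB subrr.
have PD x y : P x -> P y -> P (x + y).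
  by move=> Px Py; rewrite -[y]opprK; apply: (PB) => //; rewrite -sub0r; apply: PB.
have Psum I (s : seq I) (F : I -> R) : (forall i, P (F i)) -> P (\sum_(i <- s) F i).
  by move=> PF; elim/big_ind: _.
have Pbc x l : P (b x * c l).
  by have [y ->] := Pc l; exists (x *: y); rewrite row_sumZ.
have P1 : P 1 by rewrite -(rmorph1 c).
apply: (pushout_ind (P := P) po) => //.
- split=> // _ _ [x ->] [y ->].
  rewrite /row_sum mulr_suml; apply: (Psum) => i; rewrite mulr_sumr; apply: (Psum) => k.
  by rewrite mulrACA -rmorphM -exprD -rmorphXn.
- by move=> x; rewrite -[b x]mulr1 -(rmorph1 c).
Qed.

Let co (l : O) : 'rV[S0]_e := projT1 (cid (j_surj l)).
Let coE l : row_sum j t (co l) = l.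
Proof. by rewrite -(projT2 (cid (j_surj l))). Qed.
Let coK x : co (row_sum j t x) = x.
Proof. by apply: j_inj; rewrite coE. Qed.

(** The matrix of multiplication by [l] in the basis [t ^+ i], acting on rows from the right; [M']
    is its base change to [S]. *)
Let M (l : O) : 'M[S0]_e := \matrix_(i, k) co (l * t ^+ i) 0 k.

Let co_mulM l x : co (l * x) = co x *m M l.
Proof.
apply: j_inj; rewrite coE -{1}(coE x) /row_sum mulr_sumr.
under [RHS]eq_bigr => k _ do rewrite mxE rmorph_sum mulr_suml.
rewrite exchange_big; apply: eq_bigr => i _.
rewrite mulrCA -{1}(coE (l * _)) /row_sum mulr_sumr; apply: eq_bigr => k _.
by rewrite mxE rmorphM mulrA.
Qed.

Let M_eq (A B : 'M[S0]_e) : (forall x : O, co x *m A = co x *m B) -> A = B.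
Proof.
move=> AB; apply/row_matrixP => i.
by rewrite !rowE -[delta_mx 0 i]coK AB.
Qed.

Let MM l m : M (l * m) = M l *m M m.
Proof. by apply: M_eq => x; rewrite -co_mulM mulmxA -!co_mulM mulrCA mulrA. Qed.

Let coB l m : co (l - m) = co l - co m.
Proof. by apply: j_inj; rewrite row_sumB !coE. Qed.

Let MB l m : M (l - m) = M l - M m.
Proof.
by apply: M_eq => x; rewrite mulmxBr -!co_mulM mulrBl coB.
Qed.

Let M1 : M 1 = 1%:M.
Proof. by apply: M_eq => x; rewrite -co_mulM mul1r mulmx1. Qed.

Let Mj w : M (j w) = w%:M.
Proof.
apply: M_eq => x; rewrite -co_mulM mul_mx_scalar; apply: j_inj.
by rewrite coE row_sumZ coE.
Qed.

Let M' (l : O) : 'M[S]_e := map_mx f (M l).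
Let eps : 'rV[S]_e := map_mx f (co 1).

Let M'B : zmod_morphism M'.
Proof. by move=> l m; rewrite /M' MB map_mxB. Qed.
Let M'M : monoid_morphism M'.
Proof.
by split=> [|l m]; rewrite /M' ?M1 ?map_scalar_mx ?rmorph1 ?MM ?map_mxM.
Qed.

Let eps_M' i : eps *m M' (t ^+ i) = map_mx f (co (t ^+ i)).
Proof. by rewrite -map_mxM -co_mulM mulr1. Qed.

Let eps_Mi (i : 'I_e) : eps *m M' (t ^+ i) = delta_mx 0 i.
Proof.
by rewrite eps_M' -(row_sum_basis j t i) coK map_delta_mx.
Qed.

(** The commutant of [M' t] serves as a model of the tensor product of [S] and [O]: since [eps] is a
    cyclic vector, the commutant is spanned over [S] by the powers of [M' t] and is commutative. *)
Let P (N : 'M[S]_e) := N *m M' t = M' t *m N.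

Let PX N i : P N -> N *m M' (t ^+ i) = M' (t ^+ i) *m N.
Proof.
move=> PN; elim: i => [|i IH]; first by rewrite (M'M.1) mulmx1 mul1mx.
by rewrite exprS (M'M.2) [_ * _]/(_ *m _) mulmxA PN -mulmxA IH mulmxA.
Qed.

Let PR : subring P.
Proof.
split=> [A B PA PB||A B PA PB].
- by rewrite /P mulmxBl mulmxBr PA PB.
- by rewrite /P mulmx1 mul1mx.
- by rewrite /P [A * B]/(A *m B) -mulmxA PB mulmxA PA mulmxA.
Qed.

(* A matrix commuting with multiplication by [t] is determined by its value on
   the cyclic vector [1]. *)
Let P_eq A B : P A -> P B -> eps *m A = eps *m B -> A = B.
Proof.
move=> PA PB AB; apply/row_matrixP => i.
by rewrite !rowE -eps_Mi -!mulmxA -!PX // !mulmxA AB.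
Qed.

Let PM' l : P (M' l).
Proof.
rewrite /P; transitivity (M' (l * t)); first by rewrite (M'M.2 l t).
by rewrite mulrC (M'M.2 t l).
Qed.

Let PS (x : S) : P x%:M.
Proof. by rewrite /P scalar_mxC. Qed.

Let P_row N : P N -> N = \sum_i (eps *m N) 0 i *: M' (t ^+ i).
Proof.
move=> PN; apply: P_eq => //.
  apply: (subring_sum PR) => i; rewrite -mul_scalar_mx.
  by apply: (subringM PR); [exact: PS | exact: PM'].
rewrite mulmx_sumr [LHS]row_sum_delta.
by apply: eq_bigr => i _; rewrite -scalemxAr eps_Mi.
Qed.

Let PC A B : P A -> P B -> A * B = B * A.
Proof.
move=> PA PB; rewrite [in LHS](P_row PA) [in RHS](P_row PA) mulr_suml mulr_sumr.
apply: eq_bigr => i _; rewrite -[LHS]scalemxAl -[RHS]scalemxAr; congr (_ *: _).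
by rewrite PX.
Qed.

(** A pushout reveals the independence of elements only through its maps to other rings. Here [S]
    maps to scalar matrices and [O] to the matrices [M' l], and the row [eps] recovers the
    coefficients [x] from the image of their row sum. *)
Lemma pushout_row_sum_inj : injective (row_sum b (c t) : 'rV[S]_e -> R).
Proof.
pose E := sub_ring PR PC.
pose b' : {rmorphism S -> E} := sub_lift PR PC (f := @scalar_mx S e) PS.
pose c' : {rmorphism O -> E} := sub_lift PR PC (f := rmorph_of M'B M'M) PM'.
have [w|d [db dc] _] := po.2 E b' c'.
  by apply: sub_incl_inj; rewrite !sub_liftK /= /M' Mj map_scalar_mx.
suff dE x : eps *m sub_incl (d (row_sum b (c t) x)) = x.
  by move=> x y xy; rewrite -[x]dE -[y]dE xy.
rewrite /row_sum !rmorph_sum mulmx_sumr [RHS]row_sum_delta; apply: eq_bigr => i _.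
rewrite -rmorphXn !rmorphM db dc.
change (eps *m ((x 0 i)%:M *m M' (t ^+ i)) = x 0 i *: delta_mx 0 i).
by rewrite mul_scalar_mx -scalemxAr eps_Mi.
Qed.

End PushoutBasis.

(** * Points over perfect algebras *)

Lemma rmorph_ext (A B : pzRingType) (f g : {rmorphism A -> B}) : f =1 g -> f = g.
Proof.
case: f g => [f cf] [g cg] /= fg; have {}fg : f = g by apply: funext.
subst g; congr GRing.RMorphism.Pack.
case: cf cg => [[f1] [f2]] [[g1] [g2]].
by rewrite (Prop_irrelevance f1 g1) (Prop_irrelevance f2 g2).
Qed.

Section PerfectPoints.
Variables (p : nat) (p_pr : prime p).

Lemma perfectX_inj (A : comPzRingType) n (x y : A) : perfect p A ->
  x ^+ (p ^ n) = y ^+ (p ^ n) -> x = y.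
Proof.
move=> A_perf /eqP; have [A_p _ _] := A_perf.
by rewrite -subr_eq0 -frobXB // => /eqP/(perfectX0 A_perf)/eqP; rewrite subr_eq0 => /eqP.
Qed.

Lemma perfect_rootX (A : comPzRingType) n : perfect p A ->
  exists s : {rmorphism A -> A}, forall x, s x ^+ (p ^ n) = x.
Proof.
move=> A_perf; have [A_p _ _] := A_perf.
have [s sE] := choice (fun x => perfectX_root n x A_perf).
have sB : zmod_morphism s.
  by move=> x y; apply: (perfectX_inj (n := n) A_perf); rewrite frobXB // -!sE.
have sM : monoid_morphism s.
  split=> [|x y]; apply: (perfectX_inj (n := n) A_perf).
    by rewrite -sE expr1n.
  by rewrite exprMn -!sE.
by exists (rmorph_of sB sM) => x /=; rewrite -sE.
Qed.

Lemma point_ext (k : comPzRingType) (F : functor k) (rF : representation F)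
    (T : alg k) (f g : algHom (coord_ring rF) T) :
  Defs.fmap f (univ_pt rF) = Defs.fmap g (univ_pt rF) -> f =1 g.
Proof.
move=> fg; have [d _ dP] := univ_ptP rF (Defs.fmap g (univ_pt rF)).
by move=> x; rewrite (dP f) // (dP g).
Qed.

Lemma comorphismE (k : comPzRingType) (F G : functor k)
    (rF : representation F) (rG : representation G) (r : natTrans F G) :
  Defs.fmap (comorphism rF rG r) (univ_pt rG) = r _ (univ_pt rF).
Proof. by rewrite /comorphism; case: cid2. Qed.

Variables (k : comPzRingType) (k_p : charp p k) (F G : functor k).
Variables (rF : representation F) (rG : representation G) (r : natTrans F G).
Hypothesis r_inj : forall A : alg k, perfect p A -> injective (r A).
Hypothesis r_surj : forall (A : alg k) (y : G A), perfect p A -> exists x, r A x = y.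

(** Surjectivity over [PA] lifts the universal point of [G] to a point of [F], that is, to a map [s]
    with [s \o f] equal to [pf_in PA 0]. Injectivity over [PB] identifies [fpf \o s] with
    [pf_in PB 0]. *)
Lemma comorphism_iso_on_perfections : iso_on_perfections p (comorphism rF rG r).
Proof.
set f := comorphism rF rG r => PA PB.
set C := coord_ring rF in f PB *; set B := coord_ring rG in f PA *.
have PA_perf := perfection_perfect p_pr PA (charp_map (alg_str B) k_p).
have PB_perf := perfection_perfect p_pr PB (charp_map (alg_str C) k_p).
pose PAk := @Alg k PA (pf_in PA 0 \o alg_str B).
pose PBk := @Alg k PB (pf_in PB 0 \o alg_str C).
pose inA := @AlgHom k B PAk (pf_in PA 0) (fun=> erefl).
pose inB := @AlgHom k C PBk (pf_in PB 0) (fun=> erefl).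
have [x rx] := @r_surj PAk (Defs.fmap inA (univ_pt rG)) PA_perf.
have [s sx _] := univ_ptP rF x.
have sf b : s (f b) = pf_in PA 0 b.
  apply: (@point_ext _ _ rG PAk (alg_comp s f) inA).
  by rewrite Defs.fmap_comp comorphismE -ntmapP sx.
have [n a|fpf fpfE _] := @pf_univ _ _ PA PB (fun n => pf_in PB n \o f).
  by rewrite /= rmorphXn pf_inS.
have fpf_str c : fpf (alg_str PAk c) = alg_str PBk c.
  by rewrite /= fpfE /= alg_homP.
pose fpfk := @AlgHom k PAk PBk fpf fpf_str.
have fpf_s c : fpf (s c) = pf_in PB 0 c.
  apply: (@point_ext _ _ rF PBk (alg_comp fpfk s) inB).
  apply: (r_inj (A := PBk) PB_perf).
  rewrite !ntmapP -(comorphismE rF rG) -!Defs.fmap_comp.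
  suff fs : alg_hom (alg_comp (alg_comp fpfk s) f) =1 alg_hom (alg_comp inB f).
    by congr (Defs.fmap _ _); apply/algHom_inj/rmorph_ext.
  by move=> b; rewrite /= [s _]sf fpfE.
(* Level [n] of a perfection holds [p ^ n]-th roots of level 0, so there the inverse is [s] followed
   by the root map [R n]. *)
have [R RE] := choice (fun n => perfect_rootX n PA_perf).
have [n c|d dE _] := @pf_univ _ _ PB PA (fun n => R n \o s).
  apply: (perfectX_inj (n := n.+1) PA_perf); rewrite RE.
  by rewrite expnSr exprM RE /= rmorphXn.
exists fpf => //; exists d.
  apply: (perfection_unique (d := d \o fpf) (d' := idfun)) => n b /=.
  apply: (perfectX_inj (n := n) PA_perf); rewrite fpfE dE /= RE.
  by rewrite -[in RHS](add0n n) pf_inX; apply: sf.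
apply: (perfection_unique (d := fpf \o d) (d' := idfun)) => n c /=.
apply: (perfectX_inj (n := n) PB_perf); rewrite -rmorphXn dE /= RE fpf_s.
by rewrite -[in RHS](add0n n) pf_inX.
Qed.
End PerfectPoints.

(** * Kernels as limits of infinitesimal groups *)

Section ClosedSubfunctor.
Variables (k : comPzRingType) (F H : functor k) (rF : representation F).
Variables (io : natTrans H F) (io_inj : forall T, injective (io T)).
Variables (Q : Type) (val_ : forall T : alg k, F T -> Q -> T).
Hypothesis val_nat : forall (A B : alg k) (f : algHom A B) x q,
  val_ (Defs.fmap f x) q = f (val_ x q).
Hypothesis io_im : forall T (y : F T), (exists x, io T x = y) <-> forall q, val_ y q = 0.

Let C := coord_ring rF.
Let J : set C := fun x => forall J' : set C, ideal J' ->
  (forall q, J' (val_ (univ_pt rF) q)) -> J' x.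

Let J_ideal : ideal J.
Proof.
split=> [J' []||] //.
  move=> x y Jx Jy J' iJ' qJ'; have [_ D _] := iJ'.
  by apply: D; [apply: Jx | apply: Jy].
move=> a x Jx J' iJ' qJ'; have [_ _ M] := iJ'.
by apply: M; apply: Jx.
Qed.

Lemma closed_subfunctor_representation : inhabited (representation H).
Proof.
pose D := @Alg k (ideal_quot J_ideal) (ideal_proj J_ideal \o alg_str C).
pose pr := @AlgHom k C D (ideal_proj J_ideal) (fun=> erefl).
have /io_im[xi xiE] : forall q, val_ (Defs.fmap pr (univ_pt rF)) q = 0.
  by move=> q; rewrite val_nat; apply/ideal_proj_eq0 => J' _; apply.
constructor; apply: (@Representation k H D xi) => T y.
have [g gy g_uniq] := univ_ptP rF (io T y).
have [x Jx|f fE] := @ideal_quot_lift _ _ J_ideal _ (alg_hom g).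
  apply: (Jx (fun x => g x = 0)); first split=> [|a b ga gb|a b gb].
  - exact: rmorph0.
  - by rewrite rmorphD ga gb addr0.
  - by rewrite rmorphM gb mulr0.
  move=> q; rewrite -val_nat gy.
  by apply: (io_im _).1; exists y.
have f_str c : f (alg_str D c) = alg_str T c by rewrite fE alg_homP.
pose fk := @AlgHom k D T f f_str.
have fpr : Defs.fmap (alg_comp fk pr) (univ_pt rF) = io T y.
  rewrite -gy; congr (Defs.fmap _ _); apply/algHom_inj/rmorph_ext => x.
  exact: fE.
exists fk.
  by apply: io_inj; rewrite ntmapP xiE -Defs.fmap_comp.
move=> f' f'y z; have [x ->] := ideal_proj_surj z.
rewrite [RHS]fE -(g_uniq (alg_comp f' pr)) //.
by rewrite Defs.fmap_comp -xiE -ntmapP f'y.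
Qed.
End ClosedSubfunctor.

(** * Algebras with finitely many nilpotent generators *)

Section FiniteLocal.
Variables (p : nat) (p_pr : prime p) (k : fieldType) (D : alg k).
Hypothesis D_p : charp p D.
Variables (K : finType) (y : K -> D) (n : nat).
Hypothesis D_gen : forall P : D -> Prop, subring P ->
  (forall c, P (alg_str D c)) -> (forall i, P (y i)) -> forall x, P x.
Hypothesis y_nil : forall i, y i ^+ (p ^ n) = 0.

(** Written as a successor so that ['I_N] visibly has an element, as [inord] and [ord0] require. *)
Let N := (p ^ n).-1.+1.
Let NE : N = (p ^ n)%N.
Proof. by rewrite /N prednK // expn_gt0 prime_gt0. Qed.

Let mon (b : K -> nat) : D := \prod_i y i ^+ b i.
Let span (x : D) := exists c : {ffun K -> 'I_N} -> k,
  x = \sum_a alg_str D (c a) * mon (fun i => a i).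

Let span_mon c (b : K -> nat) : span (alg_str D c * mon b).
Proof.
have [bN|/forallPn[i]] := boolP [forall i, (b i < N)%N]; last first.
  rewrite -leqNgt => bi; exists (fun=> 0).
  rewrite big1 => [|a _]; last by rewrite rmorph0 mul0r.
  by rewrite /mon (bigD1 i) //= -(subnKC bi) exprD NE y_nil !mul0r mulr0.
pose a0 : {ffun K -> 'I_N} := [ffun i => inord (b i)].
exists (fun a => if a == a0 then c else 0); rewrite (bigD1 a0) //= eqxx.
rewrite [X in _ + X]big1 ?addr0 => [|a /negPf ->]; last by rewrite rmorph0 mul0r.
congr (_ * _); apply: eq_bigr => i _.
by rewrite ffunE inordK //; exact: (forallP bN).
Qed.

Let spanB x x' : span x -> span x' -> span (x - x').
Proof.
move=> [c ->] [c' ->]; exists (fun a => c a - c' a).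
by rewrite -sumrB; apply: eq_bigr => a _; rewrite rmorphB mulrBl.
Qed.

Let span_sum I (r : seq I) (F : I -> D) :
  (forall i, span (F i)) -> span (\sum_(i <- r) F i).
Proof.
move=> FS; have S0 : span 0.
  by have := spanB (span_mon 0 (fun=> 0%N)) (span_mon 0 (fun=> 0%N)); rewrite subrr.
elim/big_ind : _ => // x x' Sx Sx'; rewrite -[x']opprK; apply: (spanB) => //.
by rewrite -sub0r; apply: spanB.
Qed.

Let mon0 : mon (fun=> 0%N) = 1.
Proof. by rewrite /mon big1 // => i _; rewrite expr0. Qed.

Let span_all x : span x.
Proof.
apply: D_gen x; first split=> //.
- by rewrite -mon0 -[mon _]mul1r -(rmorph1 (alg_str D)); apply: span_mon.
- move=> _ _ [c ->] [c' ->]; rewrite mulr_suml; apply: (span_sum) => a.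
  rewrite mulr_sumr; apply: (span_sum) => a'.
  rewrite mulrACA -rmorphM /mon -big_split /=.
  have := span_mon (c a * c' a') (fun i => a i + a' i)%N; rewrite /mon.
  by under eq_bigr => i _ do rewrite exprD.
- by move=> c; rewrite -[alg_str D c]mulr1 -mon0; apply: span_mon.
- move=> i; have := span_mon 1 (fun i' => (i' == i) : nat).
  rewrite rmorph1 mul1r /mon (bigD1 i) //= eqxx expr1 big1 ?mulr1 //.
  by move=> i' /negPf ->.
Qed.

Lemma nilpotent_generators_finite : module_finite D.
Proof.
pose E := enum {: {ffun K -> 'I_N}}; pose a0 : {ffun K -> 'I_N} := [ffun=> ord0].
exists [seq mon (fun i => a i) | a : {ffun K -> 'I_N} <- E] => x.
have [c ->] := span_all x; exists (fun l => c (nth a0 E l)).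
have -> : \sum_a alg_str D (c a) * mon (fun i => a i) =
  \sum_(a <- E) alg_str D (c a) * mon (fun i => a i) by rewrite big_enum.
rewrite (big_nth a0) big_mkord size_map; apply: eq_bigr => l _.
congr (_ * _).
by rewrite (nth_map a0 0 (fun a : {ffun K -> _} => mon (fun i => a i))) ?ltn_ord.
Qed.

Let powk x : exists m c, x ^+ (p ^ m) = alg_str D c.
Proof.
apply: (D_gen (P := fun x => exists m c, x ^+ (p ^ m) = alg_str D c)) => [|c|i].
- split=> [a a' [m [c xc]] [m' [c' xc']]||a a' [m [c xc]] [m' [c' xc']]].
  + exists (m + m')%N, (c ^+ (p ^ m') - c' ^+ (p ^ m)).
    rewrite frobXB // rmorphB !rmorphXn -xc -xc' -!exprM -!expnD.
    by rewrite (addnC m').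
  + by exists 0%N, 1; rewrite expr1 rmorph1.
  + exists (m + m')%N, (c ^+ (p ^ m') * c' ^+ (p ^ m)).
    rewrite exprMn rmorphM !rmorphXn -xc -xc' -!exprM -!expnD.
    by rewrite (addnC m').
- by exists 0%N, c; rewrite expr1.
- by exists n, 0; rewrite y_nil rmorph0.
Qed.

(** Some [p]-power of each [x] is a scalar, and a scalar lies in a prime only if it is zero; so all
    primes have the same elements. The point [ep] supplies one. *)
Lemma nilpotent_generators_local (ep : algHom D (base_alg k)) :
  exists P : Spec D, forall Q, Q = P.
Proof.
have k0 : prime_ideal (fun c : k => c = 0).
  split; first split=> // [x y' -> ->|a x ->]; rewrite ?addr0 ?mulr0 //.
    by apply/eqP; rewrite oner_eq0.
  by move=> x x' /eqP; rewrite mulf_eq0 => /orP[]/eqP; [left | right].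
have memE (Q : Spec D) x m c : x ^+ (p ^ m) = alg_str D c -> Q x <-> c = 0.
  move=> xc; rewrite -(@primeXE _ Q x (p ^ m)) ?expn_gt0 ?prime_gt0 // xc.
  have [[Q0 _ _] Q1 _] := pidealP Q; split=> [Qc|->]; last by rewrite rmorph0.
  apply/eqP; apply: contra_notT Q1 => c0.
  by rewrite -(rmorph1 (alg_str D)) -(divff c0) rmorphM; apply: prime_mulr.
exists (spec_map ep (MkSpec k0)) => Q; apply: spec_eq => x.
have [m [c xc]] := powk x.
by rewrite (memE Q _ _ _ xc) (memE _ _ _ _ xc).
Qed.

End FiniteLocal.

Section TruncatedKernel.
Variables (p : nat) (p_pr : prime p) (k : fieldType) (k_p : charp p k).
Variables (R V : ringFunctor k) (r : ringMap R V) (rR : representation R).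
Variables (I : finType) (rc : forall A : alg k, R A -> I -> nat -> A).
Variables (vc : forall A : alg k, V A -> nat -> A) (N : nat -> nat).
Arguments rc {A}.
Arguments vc {A}.
Hypothesis rc_nat : forall (A B : alg k) (f : algHom A B) x i n,
  rc (rmap R f x) i n = f (rc x i n).
Hypothesis vc_nat : forall (A B : alg k) (f : algHom A B) y n,
  vc (rmap V f y) n = f (vc y n).
Hypothesis rc_inj : forall (A : alg k) (x y : R A),
  (forall i n, rc x i n = rc y i n) -> x = y.
Hypothesis vc_inj : forall (A : alg k) (y : V A), (forall n, vc y n = 0) -> y = 0.
Hypothesis rc_surj : forall (A : alg k) (a : I -> nat -> A),
  exists x, forall i n, rc x i n = a i n.

(** In the application these are the points with all entries in [V ^ n W(A)] and, for [vnull], the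
    elements of [V ^ n W_O(A)], with [N n = e * n]. *)
Definition rnull n (A : alg k) (x : R A) := forall i m, (m < n)%N -> rc x i m = 0.
Definition vnull n (A : alg k) (y : V A) := forall m, (m < n)%N -> vc y m = 0.
Arguments rnull n {A}.
Arguments vnull n {A}.

Hypothesis rnull_sub : forall n (A : alg k) (x y : R A),
  rnull n (x - y) <-> forall i m, (m < n)%N -> rc x i m = rc y i m.
Hypothesis vnull_sub : forall n (A : alg k) (x y : V A),
  vnull n (x - y) <-> forall m, (m < n)%N -> vc x m = vc y m.
Hypothesis r_null : forall n (A : alg k) (x : R A), rnull n x -> vnull (N n) (r A x).
Hypothesis r_strict : forall n (A : alg k) (x : R A), perfect p A ->
  vnull (N n) (r A x) -> rnull n x.
Hypotheses (N_mono : forall m n, (m <= n)%N -> (N m <= N n)%N).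
Hypotheses (N_unbounded : forall n, (n < N n.+1)%N).

Let rc0 (A : alg k) i n : rc (0 : R A) i n = 0.
Proof.
have := (rnull_sub n.+1 (0 : R A) 0).2 (fun _ _ _ => erefl).
by rewrite subrr; apply.
Qed.

Let vc0 (A : alg k) n : vc (0 : V A) n = 0.
Proof.
have := (vnull_sub n.+1 (0 : V A) 0).2 (fun _ _ => erefl).
by rewrite subrr; apply.
Qed.

Let vnullB n (A : alg k) (x y : V A) : vnull n x -> vnull n y -> vnull n (x - y).
Proof. by move=> x0 y0; apply/vnull_sub => m mn; rewrite x0 // y0. Qed.

Let vnullN n (A : alg k) (x : V A) : vnull n x -> vnull n (- x).
Proof. by move=> x0; rewrite -sub0r; apply: vnullB => // m _; rewrite vc0. Qed.

Let vnullD n (A : alg k) (x y : V A) : vnull n x -> vnull n y -> vnull n (x + y).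
Proof. by move=> x0 /vnullN; rewrite -[y in x + y]opprK; apply: vnullB. Qed.

(** A normal form modulo [rnull n]. It need not be additive, so the group laws on truncated points
    truncate again after each operation. *)
Let trunc n (A : alg k) (x : R A) : R A :=
  projT1 (cid (rc_surj (fun i m => if (m < n)%N then rc x i m else 0))).
Arguments trunc n {A}.

Let truncE n (A : alg k) (x : R A) i m :
  rc (trunc n x) i m = if (m < n)%N then rc x i m else 0.
Proof. exact: (projT2 (cid (rc_surj _))). Qed.

Let trunc_sub n (A : alg k) (x : R A) : rnull n (trunc n x - x).
Proof. by apply/rnull_sub => i m mn; rewrite truncE mn. Qed.

Let trunc_eq n (A : alg k) (x y : R A) : rnull n (x - y) -> trunc n x = trunc n y.
Proof.
move=> /rnull_sub xy; apply: rc_inj => i m; rewrite !truncE.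
by case: ifP => // mn; rewrite xy.
Qed.

Let trunc_map n (A B : alg k) (f : algHom A B) (x : R A) :
  rmap R f (trunc n x) = trunc n (rmap R f x).
Proof.
apply: rc_inj => i m; rewrite rc_nat !truncE rc_nat.
by case: ifP => // _; rewrite rmorph0.
Qed.

Let truncDl n (A : alg k) (x y : R A) : trunc n (trunc n x + y) = trunc n (x + y).
Proof. by apply: trunc_eq; rewrite opprD addrACA subrr addr0; apply: trunc_sub. Qed.

Let truncDr n (A : alg k) (x y : R A) : trunc n (x + trunc n y) = trunc n (x + y).
Proof. by rewrite addrC truncDl addrC. Qed.

(** Truncation changes [x] by an element of [rnull n], whose image vanishes in the first [N n]
    coordinates. *)
Let trunc_null n m (A : alg k) (x : R A) : (m <= N n)%N ->
  vnull m (r A x) -> vnull m (r A (trunc n x)).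
Proof.
move=> mn x0; rewrite -(subrK x (trunc n x)) rmorphD; apply: vnullD => // l lm.
exact: (r_null (@trunc_sub n A x)) (leq_trans lm mn).
Qed.

(* The kernel of the map induced by [r] between truncations at levels [n] and
   [N n], where a truncated point is represented by the point with the same first
   coordinates and zeros afterwards. *)
Let in_level n (A : alg k) (x : R A) :=
  (forall i m, (n <= m)%N -> rc x i m = 0) /\ vnull (N n) (r A x).
Arguments in_level n {A}.

Let in_level0 n (A : alg k) : in_level n (0 : R A).
Proof. by split=> [i m _|m _]; rewrite ?rc0 // rmorph0 vc0. Qed.

Let in_level_trunc n (A : alg k) (x : R A) :
  vnull (N n) (r A x) -> in_level n (trunc n x).
Proof.
split; last exact: trunc_null.
by move=> i m nm; rewrite truncE ltnNge nm.
Qed.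

Let trunc_id n (A : alg k) (x : R A) : in_level n x -> trunc n x = x.
Proof.
move=> [x0 _]; apply: rc_inj => i m; rewrite truncE.
by case: ltnP => // nm; rewrite x0.
Qed.

Record level_pt n (A : alg k) := LevelPt {
  level_val : R A; level_asP : `[< in_level n level_val >] }.
HB.instance Definition _ n A := [isSub for @level_val n A].
HB.instance Definition _ n A := [Choice of level_pt n A by <:].

Definition level_mk n (A : alg k) (x : R A) (xP : in_level n x) : level_pt n A :=
  LevelPt (introT (asboolP _) xP).

Let level_valP n (A : alg k) (x : level_pt n A) : in_level n (val x).
Proof. exact/asboolP/(valP x). Qed.

Section Group.
Variables (n : nat) (A : alg k).
Local Notation H := (level_pt n A).

Let level_one : H := level_mk (in_level0 n A).
Let level_mul (x y : H) : H.
Proof.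
refine (@level_mk n A (trunc n (val x + val y)) _); apply: in_level_trunc.
by rewrite rmorphD; apply: vnullD; [case: (level_valP x) | case: (level_valP y)].
Defined.
Let level_inv (x : H) : H.
Proof.
refine (@level_mk n A (trunc n (- val x)) _); apply: in_level_trunc.
by rewrite rmorphN; apply: vnullN; case: (level_valP x).
Defined.

Fact level_mulA : associative level_mul.
Proof. by move=> x y z; apply: val_inj; rewrite /= truncDl truncDr addrA. Qed.
Fact level_mul1 : left_id level_one level_mul.
Proof. by move=> x; apply: val_inj; rewrite /= add0r trunc_id //; apply: level_valP. Qed.
Fact level_mulr1 : right_id level_one level_mul.
Proof. by move=> x; apply: val_inj; rewrite /= addr0 trunc_id //; apply: level_valP. Qed.
Fact level_mulV : left_inverse level_one level_inv level_mul.
Proof.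
by move=> x; apply: val_inj; rewrite /= truncDl addNr trunc_id //; apply: in_level0.
Qed.
Fact level_mulrV : right_inverse level_one level_inv level_mul.
Proof.
by move=> x; apply: val_inj; rewrite /= truncDr addrN trunc_id //; apply: in_level0.
Qed.
HB.instance Definition _ := isGroup.Build H
  level_mulA level_mul1 level_mulr1 level_mulV level_mulrV.

Lemma level_valM (x y : H) : val (x * y)%g = trunc n (val x + val y).
Proof. by []. Qed.
End Group.

Section LevelMap.
Variables (n : nat) (A B : alg k) (f : algHom A B).
Fact level_map_subproof (x : level_pt n A) : in_level n (rmap R f (val x)).
Proof.
have [x0 rx0] := level_valP x; split=> [i m nm|m mn].
  by rewrite rc_nat x0 // rmorph0.
by rewrite rtmapP vc_nat rx0 // rmorph0.
Qed.
Definition level_map (x : level_pt n A) : level_pt n B :=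
  level_mk (level_map_subproof x).
Fact level_map_mul : {morph level_map : x y / (x * y)%g}.
Proof.
move=> x y; apply: val_inj.
by rewrite [LHS]/= !level_valM trunc_map rmorphD.
Qed.
HB.instance Definition _ := monoid.isMultiplicative.Build
  (level_pt n A) (level_pt n B) level_map level_map_mul.
End LevelMap.

Fact level_map_id n A (x : level_pt n A) : level_map (alg_id A) x = x.
Proof. by apply: val_inj; rewrite /= rmap_id. Qed.
Fact level_map_comp n (A B C : alg k) (g : algHom B C) (f : algHom A B)
    (x : level_pt n A) :
  level_map (alg_comp g f) x = level_map g (level_map f x).
Proof. by apply: val_inj; rewrite /= rmap_comp. Qed.

Definition level n : groupFunctor k :=
  @GroupFunctor k (fun A => level_pt n A) (fun A B f => level_map f)
    (@level_map_id n) (@level_map_comp n).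

Section Trunc.
Variables (n m : nat) (nm : (n <= m)%N).

Fact level_trunc_subproof (A : alg k) (x : level_pt m A) : in_level n (trunc n (val x)).
Proof.
apply: in_level_trunc => l ln; have [_ x0] := level_valP x.
by apply: x0; apply: leq_trans (N_mono nm).
Qed.
Definition level_trunc (A : alg k) (x : level_pt m A) : level_pt n A :=
  level_mk (level_trunc_subproof x).

Let trunc_trunc (A : alg k) (x : R A) : trunc n (trunc m x) = trunc n x.
Proof.
apply: rc_inj => i l; rewrite !truncE; case: ifP => // ln.
by rewrite (leq_trans ln nm).
Qed.

Fact level_trunc_mul A : {morph @level_trunc A : x y / (x * y)%g}.
Proof.
move=> x y; apply: val_inj.
by rewrite [LHS]/= !level_valM trunc_trunc truncDl truncDr.
Qed.
HB.instance Definition _ A := monoid.isMultiplicative.Build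
  (level_pt m A) (level_pt n A) (@level_trunc A) (@level_trunc_mul A).
Fact level_trunc_nat (A B : alg k) (f : algHom A B) (x : level_pt m A) :
  level_trunc (level_map f x) = level_map f (level_trunc x).
Proof. by apply: val_inj; rewrite /= trunc_map. Qed.
Definition level_transition : groupMap (level m) (level n) :=
  @GroupMap k (level m) (level n) (fun A => @level_trunc A) level_trunc_nat.
End Trunc.

Section Projection.
Variable n : nat.
Fact kernel_trunc_subproof (A : alg k) (x : kernel r A) :
  in_level n (trunc n (val (x : kernel_pt (r A)))).
Proof. by apply: in_level_trunc => l ln; rewrite kernelP vc0. Qed.
Definition kernel_trunc (A : alg k) (x : kernel r A) : level n A :=
  level_mk (kernel_trunc_subproof x).
Fact kernel_trunc_mul A : {morph @kernel_trunc A : x y / (x * y)%g}.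
Proof.
move=> x y; apply: val_inj.
by rewrite [LHS]/= level_valM truncDl truncDr.
Qed.
HB.instance Definition _ A := monoid.isMultiplicative.Build
  (kernel r A) (level n A) (@kernel_trunc A) (@kernel_trunc_mul A).
Fact kernel_trunc_nat (A B : alg k) (f : algHom A B) (x : kernel r A) :
  kernel_trunc (gmap (kernel r) f x) = gmap (level n) f (kernel_trunc x).
Proof. by apply: val_inj; rewrite /= trunc_map. Qed.
Definition kernel_projection : groupMap (kernel r) (level n) :=
  @GroupMap k (kernel r) (level n) (fun A => @kernel_trunc A) kernel_trunc_nat.
End Projection.

Lemma kernel_representation : inhabited (representation (kernel r)).
Proof.
pose io := @NatTrans k (kernel r) R (fun A x => val (x : kernel_pt (r A)))
  (fun A B f x => erefl).
apply: (@closed_subfunctor_representation k R (kernel r) rR io _ nat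
  (fun T y n => vc (r T y) n)) => [T x y xy|A B f x q|T y].
- exact: val_inj.
- by rewrite -vc_nat -rtmapP.
- split=> [[x <-] q|y0]; first by rewrite /= kernelP vc0.
  have ry0 : r T y == 0 by apply/eqP/vc_inj.
  by exists (KernelPt ry0 : kernel r T).
Qed.

Lemma level_representation n : inhabited (representation (level n)).
Proof.
pose io := @NatTrans k (level n) R (fun A x => val (x : level_pt n A))
  (fun A B f x => erefl).
(* The two summands index the two families of equations defining [in_level]; an index out of range
   gives a trivial equation. *)
apply: (@closed_subfunctor_representation k R (level n) rR io _ (I * nat + nat)%type
  (fun T y q => match q with
     | inl (i, m) => if (n <= m)%N then rc y i m else 0
     | inr m => if (m < N n)%N then vc (r T y) m else 0 end)) => [T x y xy|A B f x|T y].
- exact: val_inj.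
- by case=> [[i m]|m]; case: ifP => _; rewrite ?rmorph0 -?vc_nat -?rtmapP ?rc_nat.
- split=> [[x <-] q|y0].
    have [x0 rx0] := level_valP x.
    by case: q => [[i m]|m]; case: ifP => // mn; [apply: x0 | apply: rx0].
  have yP : in_level n y.
    split=> [i m nm|m mn]; first by have := y0 (inl (i, m)); rewrite nm.
    by have := y0 (inr m); rewrite mn.
  by exists (level_mk yP).
Qed.

Let level_perfect n (A : alg k) (x : level_pt n A) i m :
  perfect p A -> rc (val x) i m = 0.
Proof.
move=> A_perf; have [x0 rx0] := level_valP x.
by case: (ltnP m n) => mn; [apply: r_strict rx0 _ _ mn | apply: x0].
Qed.

Lemma level_infinitesimal n : infinitesimal (level n).
Proof.
have [rH] := level_representation n; exists rH.
set D := coord_ring rH; pose xi : level_pt n D := univ_pt rH.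
have D_p : charp p D := charp_map (alg_str D) k_p.
pose y (im : I * 'I_n) : D := rc (val xi) im.1 im.2.
(* The universal point becomes zero over the perfection of [D], and elements of [D] that vanish
   there are nilpotent. *)
have y_nil im : exists m, y im ^+ (p ^ m) = 0.
  have [PD [PD_nil _]] := perfection_exists p_pr D_p.
  apply: PD_nil; pose PDk := @Alg k PD (pf_in PD 0 \o alg_str D).
  pose inD := @AlgHom k D PDk (pf_in PD 0) (fun=> erefl).
  have <- := @level_perfect n PDk (level_map inD xi) im.1 im.2
    (perfection_perfect p_pr PD D_p).
  by rewrite /= rc_nat.
have [M yM] := choice y_nil.
have {}y_nil im : y im ^+ (p ^ \max_im M im) = 0.
  have /subnKC <- : (M im <= \max_im M im)%N by apply: leq_bigmax.
  by rewrite expnD exprM yM expr0n expn_eq0 -[(p == 0)%N]negbK -lt0n prime_gt0.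
(* The universal point has its coordinates in the subring [S] cut out by [P], hence comes from a
   point over [S]; the map classifying that point is a section of the inclusion of [S] in [D]. *)
have D_gen (P : D -> Prop) : subring P -> (forall c, P (alg_str D c)) ->
    (forall im, P (y im)) -> forall x, P x.
  move=> PR Pk Py; have PC (a b : D) : P a -> P b -> a * b = b * a by rewrite mulrC.
  pose S := @Alg k (sub_ring PR PC) (sub_lift PR PC (f := alg_str D) Pk).
  pose inc := @AlgHom k S D (sub_incl (PR := PR) (PC := PC)) (fun=> erefl).
  have inc_inj : injective inc by apply: sub_incl_inj.
  have [xi0 rxi0] := level_valP xi.
  have Pxi i m : P (rc (val xi) i m).
    case: (ltnP m n) => mn; first by have := Py (i, Ordinal mn).
    by rewrite xi0 //; apply: subring0.
  have [x xE] := rc_surj (fun i m => sub_mk (Pxi i m) : S).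
  have incx : rmap R inc x = val xi.
    by apply: rc_inj => i m; rewrite rc_nat xE.
  have xP : in_level n x.
    split=> [i m nm|m mn]; apply: inc_inj; rewrite rmorph0.
      by rewrite -rc_nat incx xi0.
    by rewrite -vc_nat -rtmapP incx rxi0.
  have [f fE _] := univ_ptP rH (level_mk xP : level n S).
  have incf a : inc (f a) = a.
    apply: (@point_ext _ _ rH D (alg_comp inc f) (alg_id D)).
    by rewrite Defs.fmap_comp Defs.fmap_id fE; apply: val_inj.
  by move=> a; rewrite -[a]incf; apply: sub_inclP.
split; first exact: (nilpotent_generators_finite p_pr D_gen y_nil).
have [ep _ _] := univ_ptP rH (level_mk (in_level0 n (base_alg k)) : level n (base_alg k)).
exact: (nilpotent_generators_local p_pr D_p D_gen y_nil ep).
Qed.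

Lemma kernel_pro_infinitesimal : pro_infinitesimal (kernel r).
Proof.
split; first exact: kernel_representation.
exists nat, (fun n m => (n <= m)%N), level.
exists (fun n m nm => level_transition nm), kernel_projection; split.
- split; last exact: level_infinitesimal.
  split=> [i|i j l||i j].
  + exact: leqnn.
  + exact: leq_trans.
  + by exists 0%N.
  + by exists (maxn i j); rewrite leq_maxl leq_maxr.
- split=> [i ii T x|i j l ij jl il T x]; apply: val_inj => /=.
    by rewrite trunc_id //; apply: level_valP.
  apply: rc_inj => a m; rewrite !truncE; case: ifP => // mi.
  by rewrite (leq_trans mi ij).
- move=> i j ij T x; apply: val_inj => /=.
  apply: rc_inj => a m; rewrite !truncE; case: ifP => // mi.
  by rewrite (leq_trans mi ij).
(* Coordinate [m] is read at level [m.+1], the first that retains it. *)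
move=> T y yt; have [x xE] := rc_surj (fun i m => rc (val (y m.+1 : level_pt _ T)) i m).
have xy n : trunc n x = val (y n : level_pt n T).
  apply: rc_inj => i m; rewrite truncE; case: ltnP => mn; last first.
    by have [y0 _] := level_valP (y n : level_pt n T); rewrite y0.
  by rewrite xE -(yt _ _ mn) /= truncE ltnSn.
(* [x] differs from its truncation at [m.+1] by an element whose image vanishes below [N m.+1],
   which exceeds [m]; the truncation itself is a point of level [m.+1]. *)
have rx0 : r T x == 0.
  apply/eqP/vc_inj => m; rewrite -[x](subrK (trunc m.+1 x)) rmorphD.
  apply: (vnullD (n := N m.+1)) => //.
    rewrite -opprB rmorphN; apply: vnullN; apply: r_null; exact: trunc_sub.
  by rewrite xy; case: (level_valP (y m.+1 : level_pt _ T)).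
exists (KernelPt rx0 : kernel r T); split=> [n|x' x'E]; first exact/val_inj/xy.
apply: val_inj; apply: rc_inj => i m /=.
rewrite xE -(x'E m.+1) /= truncE ltnSn //.
Qed.
End TruncatedKernel.

(** * The comparison morphism *)

Section Setting.
Variables (O : idomainType) (pi : O).
Hypotheses (O_dvr : is_dvr O) (pi_unif : is_uniformizer pi).
Hypotheses (O_complete : adically_complete pi) (O_char0 : [pchar {fraction O}] =i pred0).
Variables (kappa : finFieldType) (res : {rmorphism O -> kappa}).
Hypothesis res_residue : is_residue_map pi res.
Variables (p h : nat).
Hypotheses (kappa_char : p \in [pchar kappa]) (kappa_card : #|kappa| = (p ^ h)%N).
Variables (W : wittVectors (p%:Z) p) (WO : wittVectors pi (p ^ h)%N).
Variable u : ringMap (absolute O (witt W)) (witt WO).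
Hypothesis u_drinfeld : is_drinfeld_map u.

Fact p_prime : prime p.
Proof. exact: pcharf_prime kappa_char. Qed.
Let p_pr := p_prime.

Let kappa_p : charp p kappa.
Proof. exact: pcharf0 kappa_char. Qed.

Lemma alg_charp (A : alg kappa) : charp p A.
Proof. exact: charp_map (alg_str A) kappa_p. Qed.

Let h_gt0 : (0 < h)%N.
Proof.
rewrite lt0n; apply/eqP => h0; have := kappa_card; rewrite h0 expn0 => k1.
have /card_le1P/(_ (0 : kappa) isT 1) : (#|kappa| <= 1)%N by rewrite k1.
by rewrite !inE oner_eq0.
Qed.

Lemma kappa_perfect : perfect p kappa.
Proof.
have inj : injective (fun x : kappa => x ^+ p).
  move=> x y /= /eqP; rewrite -subr_eq0 -frobB // expf_eq0 => /andP[_].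
  by rewrite subr_eq0 => /eqP.
split=> // [x /eqP|x].
  by rewrite expf_eq0 => /andP[_ /eqP].
by exists (invF inj x); have := f_invF inj x.
Qed.

Let pi_neq0 : pi != 0 := uniformizer_neq0 pi_unif.
Let res_pi : res pi = 0.
Proof. by apply/(residue_eq0 res_residue); exists 1; rewrite mulr1. Qed.

(** Here [e] is the absolute ramification index: it exists because [p] is nonzero in [O], and it is
    positive because [p] dies in [kappa]. *)
Lemma prime_val : exists e v v', [/\ (0 < e)%N, v * v' = 1 & p%:R = v * pi ^+ e].
Proof.
have [e [v [v' [vv' pE]]]] := uniformizer_val O_dvr pi_unif O_complete res_residue
  (char0_prime_neq0 O_char0 p_pr).
exists e, v, v'; split=> //; rewrite lt0n; apply/eqP => e0.
have : res (v * v') = 0.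
  by rewrite rmorphM -[v]mulr1 -(expr0 pi) -e0 -pE rmorph_nat kappa_p mul0r.
by rewrite vv' rmorph1 => /eqP; rewrite oner_eq0.
Qed.

Variables (e : nat) (v v' : O).
Hypotheses (e_gt0 : (0 < e)%N) (vv' : v * v' = 1) (pE : p%:R = v * pi ^+ e).

Let pE' : p%:R = pi * (v * pi ^+ e.-1).
Proof. by rewrite pE mulrCA -exprS prednK. Qed.

Let qE : (p ^ h)%N = (p ^ h)%N. Proof. by []. Qed.

Let p_neq0 : p%:Z != 0. Proof. by rewrite eqz_nat -lt0n prime_gt0. Qed.
Let qE1 : p = (p ^ 1)%N. Proof. by rewrite expn1. Qed.

Lemma restrict_pi (A : alg kappa) : alg_str (restrict_alg res A) pi = 0.
Proof. by rewrite /= res_pi rmorph0. Qed.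

Lemma drinfeld0 (B : alg O) (b : absolute O (witt W) B) :
  wcoef (u B b) 0 = wcoef (b : witt W (Zalg B)) 0.
Proof.
have := u_drinfeld b 0; rewrite mul0n /ghost !big_ord1 !subnn !expn0 !expr1.
by rewrite !expr0 !rmorph1 !mul1r.
Qed.

(* In characteristic 0 the ghost components of [u x] are divisible by
   [p ^ k ~ pi ^ (e * k)], so Dwork's congruences make its first [e * k]
   components vanish modulo [pi]. *)
Lemma drinfeld_wnull (A : alg kappa) k (x : witt W (Zalg A)) :
  wnull k x -> wnull (e * k) (u (restrict_alg res A) x).
Proof.
move=> /(wnullP p_pr qE1 p_neq0) x0; set B := restrict_alg res A.
have [F [f [F_tf f_surj]]] := torsionfree_cover B pi_neq0.
have [s sK] := choice f_surj.
(* The initial coordinates are lifted to exact zeros, so each remaining ghost term carries a factor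
   [p ^ i] with [i] at least [k]. *)
pose X : witt W (Zalg F) :=
  wmk W (fun n => if (n < k)%N then 0 else s (wcoef x n) : Zalg F).
have -> : x = rmap (absolute O (witt W)) f X.
  apply: (@witt_ext _ _ _ W (Zalg A) x) => n.
  rewrite (wcoef_map (W := W) (Zhom f)).
  change (wcoef x n = f (if (n < k)%N then 0 else s (wcoef x n))).
  by case: ltnP => [nk|_]; rewrite ?sK // rmorph0 x0.
rewrite rtmapP; apply/(wnullP p_pr qE pi_neq0) => m mk; rewrite wcoef_map.
have D n : (n < e * k)%N -> dvd_sub pi n.+1
    (ghost pi (p ^ h) (wcoef (u F X)) n) (ghost pi (p ^ h) (fun=> 0 : F) n).
  move=> nk; rewrite (ghost0 _ p_pr qE) u_drinfeld.
  apply: (dvd_sub_weaken nk).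
  have -> : 0 = \sum_(i < (n * h).+1) (0 : F) by rewrite big1.
  apply: dvd_sub_sum => i; rewrite wcoef_mk; case: ltnP => ik.
    rewrite expr0n expn_eq0 -[(p == 0)%N]negbK -lt0n prime_gt0 // mulr0.
    exact: dvd_sub_refl.
  have -> : alg_str (Zalg F) (p%:Z ^+ i) = alg_str F (p%:R ^+ i).
    by rewrite !rmorphXn rmorph_nat /= -pmulrn.
  rewrite /dvd_sub subr0 -(subnKC ik) exprD rmorphM pE exprMn -exprM rmorphM.
  by rewrite [alg_str F (v ^+ k) * _]mulrC -!mulrA; eexists.
have [z] := ghost_dvd_sub p_pr h_gt0 qE pE' F_tf D mk.
by rewrite subr0 expr1 => ->; rewrite rmorphM alg_homP restrict_pi mul0r.
Qed.

Section Perfect.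
Variable A : alg kappa.
Hypothesis A_perf : perfect p A.
Local Notation B := (restrict_alg res A).
Local Notation t := (witt_str WO B pi : witt WO B).
Local Notation uB := (u B : {rmorphism witt W (Zalg A) -> witt WO B}).

Let B_pi : alg_str B pi = 0 := restrict_pi A.

Let vvB : (witt_str WO B v : witt WO B) * witt_str WO B v' = 1.
Proof. by rewrite -rmorphM vv' rmorph1. Qed.

Let pB : p%:R = (witt_str WO B v : witt WO B) * t ^+ e.
Proof. by rewrite -rmorphXn -rmorphM -pE rmorph_nat. Qed.

Let tX k : t ^+ k = witt_str WO B (pi ^+ k).
Proof. by rewrite rmorphXn. Qed.

Let t_reg (x : witt WO B) : t * x = 0 -> x = 0.
Proof. exact: (witt_pi_reg p_pr h_gt0 qE pE' pi_neq0 B_pi A_perf). Qed.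

Let t_sep (x : witt WO B) : (forall k, exists y, x = t ^+ k * y) -> x = 0.
Proof.
move=> xt; apply: wnull_all => k; have [y ->] := xt k.
by rewrite tX; apply: (wnull_piX p_pr h_gt0 qE pE' pi_neq0).
Qed.

Let wnull1_t (x : witt WO B) : wcoef x 0 = 0 <-> exists y, x = t * y.
Proof.
split=> [x0|[y ->]]; last by rewrite (wcoef_pi p_pr h_gt0 qE pE' pi_neq0).
have [|y ->] := wnull_piXP p_pr h_gt0 qE pE' pi_neq0 B_pi A_perf (k := 1) (x := x).
  by apply/(wnullP p_pr qE pi_neq0) => -[].
by exists y; rewrite expr1.
Qed.

Let uB0 (x : witt W (Zalg A)) : wcoef (uB x) 0 = wcoef x 0.
Proof. exact: (@drinfeld0 B x). Qed.

Let u_mod (x : witt W (Zalg A)) y : uB x = t * y -> wcoef x 0 = 0.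
Proof. by move=> xy; rewrite -uB0; apply/wnull1_t; exists y. Qed.

Let u_surj z : exists x y, z = uB x + t * y.
Proof.
(* Any vector with the zeroth coordinate of [z] would do: [u] preserves this coordinate, and vectors
   where it is zero are multiples of [t]. *)
pose x : witt W (Zalg A) := wmk W (fun=> wcoef z 0 : Zalg A).
have [|y yE] := (wnull1_t (z - uB x)).1; last by exists x, y; rewrite -yE addrC subrK.
have zx : eqto 1 (wcoef z) (wcoef (uB x)) by case=> // m _; rewrite uB0.
by have /(wnullP p_pr qE pi_neq0)/(_ 0%N isT) := (wnull_sub pi_neq0 _ _ _).2 zx.
Qed.

Lemma drinfeld_row_strict k (x : 'rV[witt W (Zalg A)]_e) :
  wnull (e * k) (row_sum uB t x) -> forall i, wnull k (x 0 i).
Proof.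
move=> /(wnull_piXP p_pr h_gt0 qE pE' pi_neq0 B_pi A_perf)[y]; rewrite -tX => xy.
exact: (row_sum_strict p_pr (alg_charp A) A_perf vvB pB t_reg u_mod xy).
Qed.

Lemma drinfeld_row_inj : injective (row_sum uB t : 'rV[witt W (Zalg A)]_e -> _).
Proof. exact: (row_sum_inj p_pr (alg_charp A) A_perf vvB pB t_reg u_mod). Qed.

Lemma drinfeld_row_surj z : exists x : 'rV[witt W (Zalg A)]_e, z = row_sum uB t x.
Proof. exact: (row_sum_surj p_pr (alg_charp A) A_perf e_gt0 vvB pB t_sep u_surj). Qed.

End Perfect.

Variable j : {rmorphism absolute kappa (witt W) (base_alg kappa) -> O}.
Hypothesis j_res : forall x : absolute kappa (witt W) (base_alg kappa),
  res (j x) = wcoef (x : witt W (Zalg kappa)) 0.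
Local Notation W0 := (absolute kappa (witt W) (base_alg kappa)).

(** This is the abstract expansion argument for [A = kappa] and target [O]: by [j_res], an element
    whose image is divisible by [pi] has zeroth coordinate 0. *)
Lemma coefficient_row_inj : injective (row_sum j pi : 'rV[W0]_e -> O).
Proof.
apply: (row_sum_inj p_pr kappa_p kappa_perfect vv' pE (t := pi)).
  by move=> x /eqP; rewrite mulf_eq0 (negPf pi_neq0) => /eqP.
by move=> x y xy; rewrite -j_res xy rmorphM res_pi mul0r.
Qed.

Lemma coefficient_row_surj l : exists x : 'rV[W0]_e, l = row_sum j pi x.
Proof.
apply: (row_sum_surj p_pr kappa_p kappa_perfect e_gt0 vv' pE).
  exact: uniformizer_sep O_dvr pi_unif.
move=> z; pose x : W0 := wmk W (fun=> res z : Zalg kappa).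
have /(residue_eq0 res_residue)[y yE] : res (z - j x) = 0.
  by rewrite rmorphB j_res subrr.
by exists x, y; rewrite -yE addrC subrK.
Qed.

Variables (RO : ringFunctor kappa) (RO_greenberg : greenberg j RO).
Variables (RO_affine : representation RO).
Variables (WOk_affine : representation (base_change res (witt WO))).
Variables (r : ringMap RO (base_change res (witt WO))).
Hypothesis r_tensor : forall (A : alg kappa) (x : absolute kappa (witt W) A) (l : O),
  r A (greenberg_l RO_greenberg A x * greenberg_r RO_greenberg A l) =
  witt_str WO (restrict_alg res A) l * u (restrict_alg res A) x.

Local Notation Wk A := (absolute kappa (witt W) A).
Local Notation gl A := (greenberg_l RO_greenberg A).
Local Notation gr A := (greenberg_r RO_greenberg A).
Local Notation grow A := (row_sum (gl A) (gr A pi) : 'rV[Wk A]_e -> RO A).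

Lemma greenberg_row_surj A x : exists y, x = grow A y.
Proof.
exact: (pushout_row_sum_surj (greenberg_pushout RO_greenberg A) coefficient_row_surj).
Qed.

Lemma greenberg_row_inj A : injective (grow A).
Proof.
exact: (pushout_row_sum_inj (greenberg_pushout RO_greenberg A)
  coefficient_row_inj coefficient_row_surj).
Qed.

Definition greenberg_row A (x : RO A) : 'rV[Wk A]_e :=
  projT1 (cid (greenberg_row_surj x)).

Lemma greenberg_rowK A x : grow A (greenberg_row x) = x.
Proof. by rewrite -(projT2 (cid (greenberg_row_surj x))). Qed.

Lemma greenberg_row_eq A x y : grow A y = x -> greenberg_row x = y.
Proof. by move=> xy; apply: greenberg_row_inj; rewrite greenberg_rowK. Qed.

Lemma greenberg_row_map A B (f : algHom A B) x :
  greenberg_row (rmap RO f x) =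
  map_mx (rmap (absolute kappa (witt W)) f) (greenberg_row x).
Proof.
apply: greenberg_row_eq; rewrite -{2}(greenberg_rowK x) rmorph_sum.
apply: eq_bigr => i _; rewrite mxE rmorphM rmorphXn rtmapP.
by rewrite (greenberg_rP RO_greenberg).
Qed.

Lemma greenberg_rowB A (x y : RO A) :
  greenberg_row (x - y) = greenberg_row x - greenberg_row y.
Proof. by apply: greenberg_row_eq; rewrite row_sumB !greenberg_rowK. Qed.

Lemma comparison_row (A : alg kappa) (x : 'rV[Wk A]_e) : r A (grow A x) =
  row_sum (u (restrict_alg res A)) (witt_str WO (restrict_alg res A) pi) x.
Proof.
rewrite rmorph_sum; apply: eq_bigr => i _.
by rewrite -rmorphXn r_tensor rmorphXn mulrC.
Qed.

Lemma comparison_inj (A : alg kappa) : perfect p A -> injective (r A).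
Proof.
move=> A_perf x y; rewrite -[x]greenberg_rowK -[y]greenberg_rowK !comparison_row.
by move=> /(drinfeld_row_inj A_perf) ->.
Qed.

Lemma comparison_surj (A : alg kappa) (y : base_change res (witt WO) A) :
  perfect p A -> exists x, r A x = y.
Proof.
move=> A_perf; have [x ->] := drinfeld_row_surj A_perf y.
by exists (grow A x); rewrite comparison_row.
Qed.

Definition greenberg_coord (A : alg kappa) (x : RO A) (i : 'I_e) : nat -> A :=
  wcoef (greenberg_row x 0 i : witt W (Zalg A)).

Definition ramified_coord (A : alg kappa) (y : base_change res (witt WO) A) : nat -> A :=
  wcoef (y : witt WO (restrict_alg res A)).

Lemma comparison_kernel : pro_infinitesimal (kernel r).
Proof.
apply: (@kernel_pro_infinitesimal p p_pr kappa kappa_p RO _ r RO_affine 'I_e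
  greenberg_coord ramified_coord (muln e)).
- move=> A B f x i n; rewrite /greenberg_coord greenberg_row_map mxE.
  exact: (wcoef_map (W := W) (Zhom f)).
- by move=> A B f y n; apply: (wcoef_map (W := WO) (restrict_hom res f)).
- move=> A x y xy; rewrite -[x]greenberg_rowK -[y]greenberg_rowK; congr (grow A _).
  by apply/rowP => i; apply: (@witt_ext _ _ _ W (Zalg A)) => n; apply: xy.
- move=> A y y0; apply: (@witt_ext _ _ _ WO _ y) => n.
  by rewrite [LHS]y0 (wcoef0 p_pr qE).
- move=> A a; exists (grow A (\row_i (wmk W (a i : nat -> Zalg A)))) => i n.
  by rewrite /greenberg_coord (greenberg_row_eq erefl) mxE.
- move=> n A x y.
  pose g x i : witt W (Zalg A) := greenberg_row x 0 i.
  have gB i : g (x - y) i = g x i - g y i by rewrite /g greenberg_rowB !mxE.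
  have gE i : wnull n (g (x - y) i) <-> eqto n (wcoef (g x i)) (wcoef (g y i)).
    by rewrite gB; apply: wnull_sub.
  split=> xy i; first by apply/gE/(wnullP p_pr qE1 p_neq0)/xy.
  exact: ((wnullP p_pr qE1 p_neq0 n (g (x - y) i)).1 ((gE i).2 (xy i))).
- move=> n A x y; pose X : witt WO (restrict_alg res A) := x.
  pose Y : witt WO (restrict_alg res A) := y; split=> xy.
    exact: ((wnull_sub pi_neq0 n X Y).1 ((wnullP p_pr qE pi_neq0 n (X - Y)).2 xy)).
  exact: ((wnullP p_pr qE pi_neq0 n (X - Y)).1 ((wnull_sub pi_neq0 n X Y).2 xy)).
(* Each entry lies in [V ^ n W(A)], which [u] maps into the ideal [V ^ (e n) W_O(A)], stable under
   the factors [pi ^+ i]. *)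
- move=> n A x x0.
  suff rx0 : wnull (e * n) (r A x : witt WO (restrict_alg res A)).
    exact: ((wnullP p_pr qE pi_neq0 _ _).1 rx0).
  rewrite -[x]greenberg_rowK comparison_row; apply: (wnull_sum pi_neq0) => i.
  rewrite mulrC; apply: (wnullM pi_neq0); apply: drinfeld_wnull.
  exact: ((wnullP p_pr qE1 p_neq0 n (greenberg_row x 0 i)).2 (x0 i)).
- move=> n A x A_perf rx0 i.
  have {}rx0 : wnull (e * n) (r A x : witt WO (restrict_alg res A)).
    exact: ((wnullP p_pr qE pi_neq0 _ (r A x : witt WO (restrict_alg res A))).2 rx0).
  rewrite -[x in r A x]greenberg_rowK comparison_row in rx0.
  exact: ((wnullP p_pr qE1 p_neq0 n (greenberg_row x 0 i)).1
    (drinfeld_row_strict A_perf rx0 i)).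
- by move=> m n mn; rewrite leq_mul2l mn orbT.
- by move=> n; rewrite leq_pmull.
Qed.

Lemma comparison_perfection : iso_on_perfections p (comorphism RO_affine WOk_affine r).
Proof.
apply: (comorphism_iso_on_perfections p_pr kappa_p) => A.
  exact: comparison_inj.
exact: comparison_surj.
Qed.

End Setting.

Theorem theorem5p3
  (O : idomainType) (pi : O)
  (O_dvr : is_dvr O) (pi_unif : is_uniformizer pi)
  (O_complete : adically_complete pi)
  (O_char0 : [pchar {fraction O}] =i pred0)
  (kappa : finFieldType) (res : {rmorphism O -> kappa})
  (res_residue : is_residue_map pi res)
  (p h : nat) (kappa_char : p \in [pchar kappa])
  (kappa_card : #|kappa| = (p ^ h)%N)
  (W : wittVectors (p%:Z) p) (WO : wittVectors pi (p ^ h)%N)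
  (u : ringMap (absolute O (witt W)) (witt WO))
  (u_drinfeld : is_drinfeld_map u)
  (j : {rmorphism absolute kappa (witt W) (base_alg kappa) -> O})
  (j_res : forall x : absolute kappa (witt W) (base_alg kappa),
     res (j x) = wcoef (x : witt W (Zalg kappa)) 0)
  (RO : ringFunctor kappa) (RO_greenberg : greenberg j RO)
  (RO_affine : representation RO)
  (WOk_affine : representation (base_change res (witt WO)))
  (r : ringMap RO (base_change res (witt WO)))
  (r_tensor : forall (A : alg kappa) (x : absolute kappa (witt W) A) (l : O),
     r A (greenberg_l RO_greenberg A x * greenberg_r RO_greenberg A l) =
     witt_str WO (restrict_alg res A) l * u (restrict_alg res A) x) :
  let r_sharp := comorphism RO_affine WOk_affine r in
  [/\ iso_on_perfections p r_sharp,
      universal_homeomorphism r_sharp,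
      spec_surjective r_sharp &
      pro_infinitesimal (kernel r)].
Proof.
have [e [v [v' [e_gt0 vv' pE]]]] :=
  prime_val O_dvr pi_unif O_complete O_char0 res_residue kappa_char.
have r_pf : iso_on_perfections p (comorphism RO_affine WOk_affine r).
  exact: (comparison_perfection O_dvr pi_unif res_residue kappa_char kappa_card
    u_drinfeld e_gt0 vv' pE j_res r_tensor).
have r_homeo := iso_on_perfections_homeomorphism (p_prime kappa_char)
  (alg_charp kappa_char (coord_ring WOk_affine)) r_pf.
split=> //; first exact: universal_homeomorphism_surjective.
exact: (comparison_kernel O_dvr pi_unif res_residue kappa_char kappa_card
  u_drinfeld e_gt0 vv' pE j_res RO_affine r_tensor).
Qed.
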